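(* Let $R$ be a commutative ring with unit, $A$ an $A_\infty$-algebra over $R$ and $M$ an $A_\infty$-bimodule over $A$. Then the spectral sequence of the length filtration of the Hochschild chain complex $(CH_*(A;M),b)$ converges to the Hochschild homology $HH_*(A;M)$.
   Context: Conventions: $\mathbb N=\{1,2,\dots\}$, $\mathbb N_0=\mathbb N\cup\{0\}$, $-\mathbb N_0=\{0,-1,-2,\dots\}$, $\otimes=\otimes_R$, graded modules are $\mathbb Z$-graded, empty sums are $0$. Formulas containing signs are stated for homogeneous elements and extended $R$-linearly. For $a\in A_j$ write $\mu(a)=j$ and $\|a\|=\mu(a)-1$. For $m\in M_j$ write $\mu(m)=j$. For $a_1,\dots,a_n\in A$ put $\maltese_i^j=\sum_{q=i}^j\|a_q\|$ for $1\le i\le j\le n$ ($0$ if $j<i$). $A_\infty$-algebra: a graded $R$-module $A=\bigoplus_j A_j$ with graded $R$-module homomorphisms $\mu_n:A^{\otimes n}\to A$ of degree $2-n$ ($n\in\mathbb N$) such that for all $r\in\mathbb N$ and $a_1,\dots,a_r\in A$ $$\sum_{n_1,n_2\in\mathbb N,\ n_1+n_2=r+1}\ \sum_{i=1}^{r+1-n_1}(-1)^{\maltese_1^{i-1}}\mu_{n_2}(a_1,\dots,a_{i-1},\mu_{n_1}(a_i,\dots,a_{i+n_1-1}),a_{i+n_1},\dots,a_r)=0.$$ $A_\infty$-bimodule over $A$: a graded $R$-module $M=\bigoplus_jM_j$ with $R$-module homomorphisms $\mu^M_{r,s}:A^{\otimes r}\otimes M\otimes A^{\otimes s}\to M$ of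 degree $1-r-s$ ($r,s\in\mathbb N_0$) such that for all $r,s\in\mathbb N_0$, $m\in M$, $a_1,\dots,a_{r+s}\in A$ (with $\maltese$ computed from the $a_q$ only): $$\sum_{r_1\in\mathbb N_0,r_2\in\mathbb N,\ r_1+r_2=r+1}\sum_{i=1}^{r_1}(-1)^{\maltese_1^{i-1}}\mu^M_{r_1,s}(a_1,\dots,a_{i-1},\mu_{r_2}(a_i,\dots,a_{i+r_2-1}),a_{i+r_2},\dots,a_r,m,a_{r+1},\dots,a_{r+s})$$ $$+\sum_{r_1+r_2=r}\ \sum_{s_1+s_2=s}(-1)^{\maltese_1^{r_1}}\mu^M_{r_1,s_1}(a_1,\dots,a_{r_1},\mu^M_{r_2,s_2}(a_{r_1+1},\dots,a_r,m,a_{r+1},\dots,a_{r+s_2}),a_{r+s_2+1},\dots,a_{r+s})$$ $$+\sum_{s_1\in\mathbb N_0,s_2\in\mathbb N,\ s_1+s_2=s+1}\sum_{j=1}^{s_1}(-1)^{\maltese_1^{r+j-1}+\mu(m)}\mu^M_{r,s_1}(a_1,\dots,a_r,m,a_{r+1},\dots,a_{r+j-1},\mu_{s_2}(a_{r+j},\dots,a_{r+j+s_2-1}),a_{r+j+s_2},\dots,a_{r+s})=0,$$ where in the second line $r_1,r_2,s_1,s_2\in\mathbb N_0$. Hochschild chains: $CH_*(A;M)=\bigoplus_{n\ge0}M\otimes A^{\otimes n}$, graded by $\deg(m\otimes a_1\otimes\dots\otimes a_n)=n-\mu(m)-\sum_{q=1}^n\mu(a_q)$. For $m\otimes a_1\otimes\dots\otimes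 a_n$ put $\maltese_0^i=\mu(m)+\maltese_1^i$ and $*_{i}=\maltese_0^{i}\cdot\maltese_{i+1}^n$. The Hochschild differential (which lowers degree by one and squares to zero) is $$b(m\otimes a_1\otimes\dots\otimes a_n)=\sum_{l=1}^{n+1}\Big(\mu^M_{0,l-1}(m,a_1,\dots,a_{l-1})\otimes a_l\otimes\dots\otimes a_n$$ $$+\sum_{i=1}^{n-l+1}(-1)^{\maltese_0^{i-1}}m\otimes a_1\otimes\dots\otimes a_{i-1}\otimes\mu_l(a_i,\dots,a_{i+l-1})\otimes a_{i+l}\otimes\dots\otimes a_n$$ $$+\sum_{i=n-l+2}^{n}(-1)^{*_{i-1}}\mu^M_{n-i+1,\,i+l-n-2}(a_i,\dots,a_n,m,a_1,\dots,a_{i+l-n-2})\otimes a_{i+l-n-1}\otimes\dots\otimes a_{i-1}\Big).$$ $HH_*(A;M)$ is the homology of $(CH_*(A;M),b)$. Length filtration: $F_pCH_*(A;M)=\bigoplus_{i=0}^pM\otimes A^{\otimes i}$ for $p\in\mathbb N_0$ and $F_pCH_*(A;M)=0$ for $p<0$; this is an increasing filtration by subcomplexes with union $CH_*(A;M)$. Spectral sequence of the length filtration: put $E_{p,-q}=F_pCH_{p-q}(A;M)$ for $p,q\in\mathbb N_0$ and $E_{p,q}=0$ if $(p,q)\notin\mathbb N_0\times(-\mathbb N_0)$. For $r\in\mathbb N_0$ and $p,q\in\mathbb N_0$ put $$Z^r_{p,-q}=\{x\in F_pCH_{p-q}(A;M): b(x)\in F_{p-r}CH_{p-q-1}(A;M)\},$$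 $$B^r_{p,-q}=\{x\in F_pCH_{p-q}(A;M): x\in b(F_{p+r}CH_{p-q+1}(A;M))\},$$ $$Z^\infty_{p,-q}=\{x\in F_pCH_{p-q}(A;M): b(x)=0\},\qquad B^\infty_{p,-q}=\{x\in F_pCH_{p-q}(A;M): x\in\mathrm{im}\,b\},$$ and $Z^r_{p,q}=B^r_{p,q}=0$ for $(p,q)\in\mathbb Z^2\setminus(\mathbb N_0\times(-\mathbb N_0))$. From these sets (elements surviving to, respectively inducing boundaries on, the $r$-th page) one constructs the spectral sequence of the filtration in the usual way. Its zeroth page is $E^0_{p,-q}=F_pCH_{p-q}(A;M)/F_{p-1}CH_{p-q}(A;M)$ with the differential $\bar b^0:E^0_{p,-q}\to E^0_{p,-q-1}$ induced by $b$; its first page is $E^1_{p,-q}=H_{-q}(E^0_{p,*},\bar b^0)$ for $p,q\in\mathbb N_0$ and $E^1_{p,q}=0$ for $(p,q)\in\mathbb Z^2\setminus(\mathbb N_0\times(-\mathbb N_0))$. Convergence is meant in the usual sense for the spectral sequence of a filtered complex: the limit terms are identified with the associated graded pieces $F_pHH_n(A;M)/F_{p-1}HH_n(A;M)$, where $n$ is the total degree and $F_pHH_n(A;M)=\mathrm{im}\big(H_n(F_pCH_*(A;M),b)\to HH_n(A;M)\big)$.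
   Formalization: The terms E, Z^r, B^r are not set to 0 outside N_0 x (-N_0): the spectral sequence is taken at all (p,q) in Z^2, since with Z-graded A, M the truncation breaks convergence (A=0, M=R in degree -1: F_0HH_1=R lies at (0,1)). It agrees with the paper's when A, M are nonnegatively graded. *)

(* Defs.v *)
From HB Require Import structures.
From mathcomp Require Import all_boot all_order all_algebra.
From mathcomp Require Import finmap.
From mathcomp Require Import boolp classical_sets functions cardinality fsbigop.

Set Implicit Arguments.
Unset Strict Implicit.
Unset Printing Implicit Defensive.

Import Order.TTheory GRing.Theory Num.Theory.

Local Open Scope classical_set_scope.
Local Open Scope ring_scope.
Local Open Scope quotient_scope.

Section Submodules.
Variable R : pzRingType.

Definition is_submodule (V : lmodType R) (S : set V) : Prop :=
  S 0 /\ forall (a : R) (x y : V), S x -> S y -> S (a *: x + y).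

Record submodule (V : lmodType R) := Submodule {
  submodule_set :> V -> Prop;
  submoduleP : is_submodule submodule_set
}.

Section Theory.
Variables (V : lmodType R) (W : submodule V).

Lemma submodule0 : W 0.
Proof. exact: (submoduleP W).1. Qed.

Lemma submoduleL (a : R) (x y : V) : W x -> W y -> W (a *: x + y).
Proof. exact: (submoduleP W).2. Qed.

Definition submodule_pred : {pred V} := [pred x | x \in (W : set V)].

Lemma submodule_predP : submod_closed submodule_pred.
Proof.
split; first by rewrite !inE; exact: submodule0.
by move=> a x y; rewrite !inE; exact: submoduleL.
Qed.

HB.instance Definition _ :=
  GRing.isSubmodClosed.Build R V submodule_pred submodule_predP.

Record submodule_elt := SubmoduleElt {
  submodule_val : V;
  _ : submodule_val \in submodule_pred
}.

HB.instance Definition _ := [isSub for submodule_val].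
HB.instance Definition _ := [Choice of submodule_elt by <:].
HB.instance Definition _ := [SubChoice_isSubLmodule of submodule_elt by <:].

Lemma submodule_in (x : V) : W x -> x \in submodule_pred.
Proof. by rewrite !inE. Qed.

Lemma submodule_elt_in (x : submodule_elt) : W (val x).
Proof. by have := valP x; rewrite !inE. Qed.

Definition quotient_module := Quotient.quot submodule_pred.

HB.instance Definition _ := GRing.Zmodule.on quotient_module.

Definition quotient_class (x : V) : quotient_module :=
  \pi_(Quotient.quot submodule_pred) x.

Definition quotient_repr (c : quotient_module) : V :=
  repr (c : Quotient.quot submodule_pred).

Lemma quotient_reprK : cancel quotient_repr quotient_class.
Proof. by move=> c; rewrite /quotient_class reprK. Qed.

Lemma quotient_classP (x y : V) :
  quotient_class x = quotient_class y <-> W (x - y).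
Proof.
have -> : W (x - y) <-> x - y \in submodule_pred by rewrite !inE.
rewrite Quotient.idealrBE; by split=> /eqP.
Qed.

Fact quotient_classD : {morph quotient_class : x y / x + y}.
Proof. by move=> x y; exact: Quotient.pi_add. Qed.

Definition quotient_scale (a : R) (c : quotient_module) : quotient_module :=
  quotient_class (a *: quotient_repr c).

Fact quotient_scaleE (a : R) (x : V) :
  quotient_scale a (quotient_class x) = quotient_class (a *: x).
Proof.
apply/quotient_classP; rewrite -scalerBr -[_ *: _]addr0.
by apply: submoduleL submodule0; apply/quotient_classP/quotient_reprK.
Qed.

Fact quotient_scaleA a b c :
  quotient_scale a (quotient_scale b c) = quotient_scale (a * b) c.
Proof. by rewrite -[c]quotient_reprK !quotient_scaleE scalerA. Qed.

Fact quotient_scale1 : left_id 1 quotient_scale.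
Proof. by move=> c; rewrite -[c]quotient_reprK quotient_scaleE scale1r. Qed.

Fact quotient_scaleDr : right_distributive quotient_scale +%R.
Proof.
move=> a c d; rewrite -[c]quotient_reprK -[d]quotient_reprK.
by rewrite -quotient_classD !quotient_scaleE scalerDr quotient_classD.
Qed.

Fact quotient_scaleDl c : {morph quotient_scale^~ c : a b / a + b}.
Proof.
move=> a b; rewrite -[c]quotient_reprK !quotient_scaleE.
by rewrite scalerDl quotient_classD.
Qed.

HB.instance Definition _ := GRing.Zmodule_isLmodule.Build R quotient_module
  quotient_scaleA quotient_scale1 quotient_scaleDr quotient_scaleDl.

Fact quotient_class_linear : linear quotient_class.
Proof. by move=> a x y; rewrite quotient_classD -quotient_scaleE. Qed.

HB.instance Definition _ :=
  GRing.isLinear.Build R V quotient_module *:%R quotient_class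
    quotient_class_linear.

End Theory.

Section Operations.
Variables U V : lmodType R.

Fact submodule_add_subproof (W1 W2 : submodule V) :
  is_submodule (fun x => exists y z, [/\ W1 y, W2 z & x = y + z]).
Proof.
split; first by exists 0, 0; rewrite addr0; split=> //; exact: submodule0.
move=> a _ _ [y1 [z1 [Wy1 Wz1 ->]]] [y2 [z2 [Wy2 Wz2 ->]]].
exists (a *: y1 + y2), (a *: z1 + z2); split; try exact: submoduleL.
by rewrite scalerDr addrACA.
Qed.

Definition submodule_add (W1 W2 : submodule V) : submodule V :=
  Submodule (submodule_add_subproof W1 W2).

Fact submodule_span_subproof (S : set V) :
  is_submodule (fun x => forall W : submodule V, (forall y, S y -> W y) -> W x).
Proof.
split; first by move=> W _; exact: submodule0.
by move=> a x y Tx Ty W SW; apply: submoduleL; [exact: Tx|exact: Ty].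
Qed.

Definition submodule_span (S : set V) : submodule V :=
  Submodule (submodule_span_subproof S).

Variable f : {linear U -> V}.

Fact submodule_ker_subproof :
  is_submodule (fun x => f x = 0).
Proof.
split; first exact: linear0.
by move=> a x y fx fy; rewrite linearP fx fy scaler0 addr0.
Qed.

Definition submodule_ker : submodule U :=
  Submodule submodule_ker_subproof.

Fact submodule_range_subproof :
  is_submodule (fun y => exists x, y = f x).
Proof.
split; first by exists 0; rewrite linear0.
by move=> a _ _ [x ->] [y ->]; exists (a *: x + y); rewrite linearP.
Qed.

Definition submodule_range : submodule V :=
  Submodule submodule_range_subproof.

End Operations.

Section Subquotient.
Variables (V : lmodType R) (Z B : submodule V).

Fact submodule_restr_subproof :
  is_submodule (fun x : submodule_elt Z => B (val x)).
Proof.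
split; first by rewrite raddf0; exact: submodule0.
by move=> a x y Bx By; rewrite linearP; exact: submoduleL.
Qed.

Definition submodule_restr : submodule (submodule_elt Z) :=
  Submodule submodule_restr_subproof.

Definition subquotient : lmodType R := quotient_module submodule_restr.

Definition subquotient_class (x : V) (Zx : Z x) : subquotient :=
  quotient_class submodule_restr (SubmoduleElt (submodule_in Zx)).

End Subquotient.

End Submodules.

Section FreeModule.
Variables (R : pzRingType) (G : choiceType).

Fact finite_support_subproof :
  is_submodule (fun f : G -> R^o => finite_set [set g | f g != 0]).
Proof.
split.
  rewrite (_ : [set g | _] = set0) ?finite_set0 //.
  by apply/seteqP; split=> g //=; rewrite eqxx.
move=> a f h ff fh; apply: (@sub_finite_set _ _ ([set g | f g != 0] `|` [set g | h g != 0])).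
  move=> g /= fhg; case: (eqVneq (f g) 0) => [f0|]; last by left.
  case: (eqVneq (h g) 0) => [h0|]; last by right.
  move/negP: fhg; case; apply/eqP.
  by change (a *: f g + h g = 0); rewrite f0 h0 scaler0 addr0.
by rewrite finite_setU.
Qed.

Definition free_module := submodule_elt (Submodule finite_support_subproof).

HB.instance Definition _ := GRing.Lmodule.on free_module.

Fact free_gen_subproof (g : G) :
  finite_set [set h | (h == g)%:R != 0 :> R^o].
Proof.
apply: (@sub_finite_set _ _ [set g]); last exact: finite_set1.
by move=> h /=; case: (eqVneq h g) => // _; rewrite eqxx.
Qed.

Definition free_gen (g : G) : free_module :=
  SubmoduleElt (@submodule_in _ _ (Submodule finite_support_subproof)
    (fun h => (h == g)%:R) (free_gen_subproof g)).

Variables (V : lmodType R) (phi : G -> V).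

Definition free_lift (f : free_module) : V :=
  \sum_(g \in [set: G]) (val f g : R) *: phi g.

Lemma free_liftE (f : free_module) (X : {fset G}) :
  (forall g, g \notin X -> val f g = 0) ->
  free_lift f = \sum_(g <- X) (val f g : R) *: phi g.
Proof.
by move=> f0; apply: fsbigTE => g /f0 ->; rewrite scale0r.
Qed.

Lemma free_supp (f : free_module) :
  exists X : {fset G}, forall g, g \notin X -> val f g = 0.
Proof.
have /= /finite_fsetP [X XE] := submodule_elt_in f.
exists X => g gX; apply/eqP/negPn/negP => fg.
have : [set` X] g by rewrite -XE.
by move=> /= gX'; rewrite gX' in gX.
Qed.

Fact free_lift_linear : linear free_lift.
Proof.
move=> a f h; have [X Xf] := free_supp f; have [Y Yh] := free_supp h.
have Zf g : g \notin (X `|` Y)%fset -> val f g = 0.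
  by rewrite in_fsetU negb_or => /andP [/Xf].
have Zh g : g \notin (X `|` Y)%fset -> val h g = 0.
  by rewrite in_fsetU negb_or => /andP [_ /Yh].
rewrite (free_liftE Zf) (free_liftE Zh) (@free_liftE _ (X `|` Y)%fset).
  rewrite scaler_sumr -big_split /=; apply: eq_bigr => g _.
  by rewrite scalerA -scalerDl.
move=> g gXY; change (a *: (val f g) + val h g = 0).
by rewrite Zf // Zh // scaler0 addr0.
Qed.

HB.instance Definition _ :=
  GRing.isLinear.Build R free_module V *:%R free_lift free_lift_linear.

Lemma free_lift_gen (g : G) : free_lift (free_gen g) = phi g.
Proof.
rewrite (@free_liftE _ [fset g]%fset).
  by rewrite big_seq_fset1 /= eqxx scale1r.
by move=> h; rewrite in_fset1 /= => /negPf ->.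
Qed.

End FreeModule.
Section FilteredComplex.
Variables (R : pzRingType) (C : lmodType R).
(* [Cn n] is the degree [n] part of [C], and [F p n] is [F_p C_n]. *)
Variables (Cn : int -> submodule C) (F : int -> int -> submodule C).
Variable b : {linear C -> C}.

Definition filtered_complex : Prop :=
  [/\ (forall n x, Cn n x -> Cn (n - 1) (b x)) /\ (forall x, b (b x) = 0),
      forall p n x, F p n x -> F p (n - 1) (b x),
      forall p n x, F (p - 1) n x -> F p n x
    & forall n x, Cn n x <-> exists p, F p n x].

Fact Zr_subproof (r : nat) (p q : int) : is_submodule
  (fun x => F p (p + q) x /\ F (p - r%:Z) (p + q - 1) (b x)).
Proof.
split; first by rewrite linear0; split; exact: submodule0.
move=> a x y [Fx Fbx] [Fy Fby]; rewrite linearP.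
by split; exact: submoduleL.
Qed.

Definition Zr r p q := Submodule (Zr_subproof r p q).

Fact Br_subproof (r : nat) (p q : int) : is_submodule
  (fun x => F p (p + q) x /\
            exists y, F (p + r%:Z) (p + q + 1) y /\ x = b y).
Proof.
split.
  split; first exact: submodule0.
  by exists 0; rewrite linear0; split=> //; exact: submodule0.
move=> a x y [Fx [x' [Fx' xE]]] [Fy [y' [Fy' yE]]].
split; first exact: submoduleL.
by exists (a *: x' + y'); rewrite linearP xE yE; split=> //; exact: submoduleL.
Qed.

Definition Br r p q := Submodule (Br_subproof r p q).

Fact Zoo_subproof (p q : int) : is_submodule
  (fun x => F p (p + q) x /\ b x = 0).
Proof.
split; first by rewrite linear0; split=> //; exact: submodule0.
move=> a x y [Fx bx] [Fy bv]; rewrite linearP bx bv scaler0 addr0.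
by split=> //; exact: submoduleL.
Qed.

Definition Zoo p q := Submodule (Zoo_subproof p q).

Fact Boo_subproof (p q : int) : is_submodule
  (fun x => F p (p + q) x /\ exists y, Cn (p + q + 1) y /\ x = b y).
Proof.
split.
  split; first exact: submodule0.
  by exists 0; rewrite linear0; split=> //; exact: submodule0.
move=> a x y [Fx [x' [Fx' xE]]] [Fy [y' [Fy' yE]]].
split; first exact: submoduleL.
by exists (a *: x' + y'); rewrite linearP xE yE; split=> //; exact: submoduleL.
Qed.

Definition Boo p q := Submodule (Boo_subproof p q).

(* Elements of [Zr r p q] representing 0 on the [r]-th page; for [r = 0] this
   gives [E^0_{p,q} = F_p C_{p+q} / F_{p-1} C_{p+q}], because [Zr 0 p q] is all
   of [F_p C_{p+q}] as soon as [F_p C] is a subcomplex. *)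
Definition page_zero (r : nat) (p q : int) : submodule C :=
  if r is r'.+1 then submodule_add (Zr r' (p - 1) (q + 1)) (Br r' p q)
  else F (p - 1) (p + q).

Definition page (r : nat) (p q : int) : lmodType R :=
  subquotient (Zr r p q) (page_zero r p q).

Definition page_class r p q x (Zx : Zr r p q x) : page r p q :=
  subquotient_class (page_zero r p q) Zx.

Definition limit_page (p q : int) : lmodType R :=
  subquotient (Zoo p q) (submodule_add (Zoo (p - 1) (q + 1)) (Boo p q)).

Definition limit_class p q x (Zx : Zoo p q x) : limit_page p q :=
  subquotient_class (submodule_add (Zoo (p - 1) (q + 1)) (Boo p q)) Zx.

(* Source and target are separate indices, linked by equations, so that the
   differentials into and out of [E^r_{p,q}] need no transport. *)
Definition page_differentials : Type :=
  forall (r : nat) (p q p' q' : int),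
    p' = p - r%:Z -> q' = q + r%:Z - 1 -> {linear page r p q -> page r p' q'}.

Fact incoming_p (r : nat) (p : int) : p = p + r%:Z - r%:Z.
Proof. by rewrite addrK. Qed.

Fact incoming_q (r : nat) (q : int) : q = q - r%:Z + 1 + r%:Z - 1.
Proof. by rewrite [q - _ + 1]addrAC subrK addrK. Qed.

Section PageHomology.
Variable d : page_differentials.

Definition d_out (r : nat) (p q : int) :
    {linear page r p q -> page r (p - r%:Z) (q + r%:Z - 1)} :=
  d (erefl (p - r%:Z)) (erefl (q + r%:Z - 1)).

Definition d_in (r : nat) (p q : int) :
    {linear page r (p + r%:Z) (q - r%:Z + 1) -> page r p q} :=
  d (incoming_p r p) (incoming_q r q).

Definition page_homology (r : nat) (p q : int) : lmodType R :=
  subquotient (submodule_ker (d_out r p q)) (submodule_range (d_in r p q)).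

Definition page_homology_class r p q c (Kc : submodule_ker (d_out r p q) c) :
    page_homology r p q :=
  subquotient_class (submodule_range (d_in r p q)) Kc.

Definition is_spectral_sequence : Prop :=
  [/\
    forall r p q p' q' (ep : p' = p - r%:Z) (eq : q' = q + r%:Z - 1)
        x (Zx : Zr r p q x),
      exists Zbx : Zr r p' q' (b x),
        d ep eq (page_class Zx) = page_class Zbx,
    forall r p q c, d_out r p q (d_in r p q c) = 0
  & forall r p q, exists phi : {linear page r.+1 p q -> page_homology r p q},
      bijective phi /\
      forall x (Zx' : Zr r.+1 p q x),
        exists (Zx : Zr r p q x)
               (Kx : submodule_ker (d_out r p q) (page_class Zx)),
          phi (page_class Zx') = page_homology_class Kx].

End PageHomology.

Fact cycles_subproof (n : int) : is_submodule (fun x => Cn n x /\ b x = 0).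
Proof.
split; first by rewrite linear0; split=> //; exact: submodule0.
move=> a x y [Cx bx] [Cy bv]; rewrite linearP bx bv scaler0 addr0.
by split=> //; exact: submoduleL.
Qed.

Definition cycles n := Submodule (cycles_subproof n).

Fact boundaries_subproof (n : int) :
  is_submodule (fun x => exists y, Cn (n + 1) y /\ x = b y).
Proof.
split; first by exists 0; rewrite linear0; split=> //; exact: submodule0.
move=> a _ _ [x [Cx ->]] [y [Cy ->]]; exists (a *: x + y).
by rewrite linearP; split=> //; exact: submoduleL.
Qed.

Definition boundaries n := Submodule (boundaries_subproof n).

Definition homology (n : int) : lmodType R :=
  subquotient (cycles n) (boundaries n).

Definition homology_class n x (Zx : cycles n x) : homology n :=
  subquotient_class (boundaries n) Zx.

(* The image of [H_n(F_p C)] in [H_n(C)]. *)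
Fact homology_filtration_subproof (p n : int) : is_submodule
  (fun c : homology n =>
     exists x (Zx : cycles n x), F p n x /\ c = homology_class Zx).
Proof.
split.
  exists 0, (submodule0 _); split; first exact: submodule0.
  rewrite /homology_class /subquotient_class -[LHS](raddf0 (quotient_class _)).
  by congr quotient_class; exact: val_inj.
move=> a _ _ [x [Zx [Fx ->]]] [y [Zy [Fy ->]]].
exists (a *: x + y), (submoduleL a Zx Zy); split; first exact: submoduleL.
rewrite /homology_class /subquotient_class -linearP.
by congr quotient_class; exact: val_inj.
Qed.

Definition homology_filtration p n : submodule (homology n) :=
  Submodule (homology_filtration_subproof p n).

Definition homology_graded (p n : int) : lmodType R :=
  subquotient (homology_filtration p n) (homology_filtration (p - 1) n).

Definition homology_graded_class p n c (Fc : homology_filtration p n c) :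
    homology_graded p n :=
  subquotient_class (homology_filtration (p - 1) n) Fc.

(* [limit_page] is the limit of the pages (first two clauses) and is the graded
   module of a filtration of the homology which is exhaustive and bounded
   below. *)
Definition converges_to_homology : Prop :=
  [/\ forall p q x, Zoo p q x <-> forall r, Zr r p q x,
      forall p q x, Boo p q x <-> exists r, Br r p q x,
      forall p q,
        exists psi : {linear limit_page p q -> homology_graded p (p + q)},
          bijective psi /\
          forall x (Zx : Zoo p q x),
            exists (Cx : cycles (p + q) x)
                   (Fx : homology_filtration p (p + q) (homology_class Cx)),
              psi (limit_class Zx) = homology_graded_class Fx,
      forall n (c : homology n), exists p, homology_filtration p n c
    & forall n, exists p, forall c, homology_filtration p n c -> c = 0].

End FilteredComplex.

(* A graded module is given by its homogeneous parts, and an element of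
   [homogeneous V] is a homogeneous element together with its degree [tag]. *)
Notation graded_module R := (int -> lmodType R).

Definition homogeneous (R : pzRingType) (V : graded_module R) : Type :=
  {j : int & V j}.

HB.instance Definition _ (R : pzRingType) (V : graded_module R) :=
  gen_eqMixin (homogeneous V).
HB.instance Definition _ (R : pzRingType) (V : graded_module R) :=
  gen_choiceMixin (homogeneous V).

Definition homog (R : pzRingType) (V : graded_module R) (j : int) (x : V j) :
    homogeneous V :=
  existT _ j x.

Definition mdeg (R : pzRingType) (V : graded_module R) (x : homogeneous V) :
    int :=
  tag x.

Definition total_degree (R : pzRingType) (V : graded_module R)
    (s : seq (homogeneous V)) : int :=
  \sum_(a <- s) mdeg a.

(* [slice s i j] is [a_i, ..., a_j] for [s = a_1, ..., a_n] and [1 <= i];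
   it is empty if [j < i]. *)
Definition slice (T : Type) (s : seq T) (i j : nat) : seq T :=
  drop i.-1 (take j s).

Definition maltese (R : pzRingType) (V : graded_module R)
    (s : seq (homogeneous V)) (i j : nat) : int :=
  \sum_(a <- slice s i j) (mdeg a - 1).

Definition sign (R : pzRingType) (k : int) : R := (-1) ^+ `|k|%N.

(* The operations [mu_n] on lists of length [n] form a single function on
   lists; its value on a list of homogeneous elements is given through its
   components in all degrees, all but one of which vanish. Multilinearity in
   the entries of fixed degrees is linearity on [A^{\otimes n}]. Only the
   operations with [n >= 1] are ever used. In the relations below the arity of
   an outer operation is not displayed: it is the length of its argument. *)
Definition mu_homog (R : pzRingType) (V : graded_module R)
    (mu : seq (homogeneous V) -> forall d : int, V d)
    (s : seq (homogeneous V)) : homogeneous V :=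
  homog (mu s (total_degree s + 2 - (size s)%:Z)).

Record ainf_algebra (R : comPzRingType) := AinfAlgebra {
  ainf_module :> graded_module R;
  ainf_mu : seq (homogeneous ainf_module) -> forall d : int, ainf_module d;
  ainf_mu_degree : forall s d,
    d <> total_degree s + 2 - (size s)%:Z -> ainf_mu s d = 0;
  ainf_mu_linear : forall s1 s2 j d,
    linear (fun x : ainf_module j => ainf_mu (s1 ++ homog x :: s2) d);
  ainf_mu_relation : forall (a : seq (homogeneous ainf_module)) (d : int),
    let r := size a in
    (0 < r)%N ->
    \sum_(1 <= n1 < r.+1) \sum_(1 <= i < (r.+1 - n1).+1)
      sign R (maltese a 1 i.-1) *:
      ainf_mu (slice a 1 i.-1 ++
               mu_homog ainf_mu (slice a i (i + n1).-1) ::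
               slice a (i + n1) r) d
    = 0
}.

Definition muM_homog (R : pzRingType) (A M : graded_module R)
    (muM : seq (homogeneous A) -> homogeneous M -> seq (homogeneous A) ->
           forall d : int, M d)
    (s : seq (homogeneous A)) (m : homogeneous M) (t : seq (homogeneous A)) :
    homogeneous M :=
  homog (muM s m t (total_degree s + mdeg m + total_degree t
                    + 1 - (size s)%:Z - (size t)%:Z)).

Record ainf_bimodule (R : comPzRingType) (A : ainf_algebra R) := AinfBimodule {
  bimod_module :> graded_module R;
  bimod_mu : seq (homogeneous A) -> homogeneous bimod_module ->
             seq (homogeneous A) -> forall d : int, bimod_module d;
  bimod_mu_degree : forall s m t d,
    d <> total_degree s + mdeg m + total_degree t
         + 1 - (size s)%:Z - (size t)%:Z ->
    bimod_mu s m t d = 0;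
  bimod_mu_linearl : forall s1 s2 m t j d,
    linear (fun x : A j => bimod_mu (s1 ++ homog x :: s2) m t d);
  bimod_mu_linearm : forall s t j d,
    linear (fun x : bimod_module j => bimod_mu s (homog x) t d);
  bimod_mu_linearr : forall s m t1 t2 j d,
    linear (fun x : A j => bimod_mu s m (t1 ++ homog x :: t2) d);
  bimod_mu_relation : forall (r s : nat) (m : homogeneous bimod_module)
      (a : seq (homogeneous A)) (d : int),
    size a = (r + s)%N ->
    \sum_(1 <= r2 < r.+2) \sum_(1 <= i < (r.+1 - r2).+1)
      sign R (maltese a 1 i.-1) *:
      bimod_mu (slice a 1 i.-1 ++
                mu_homog (@ainf_mu R A) (slice a i (i + r2).-1) ::
                slice a (i + r2) r)
               m (slice a r.+1 (r + s)) d
    + \sum_(0 <= r1 < r.+1) \sum_(0 <= s2 < s.+1)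
      sign R (maltese a 1 r1) *:
      bimod_mu (slice a 1 r1)
               (muM_homog bimod_mu (slice a r1.+1 r) m (slice a r.+1 (r + s2)))
               (slice a (r + s2).+1 (r + s)) d
    + \sum_(1 <= s2 < s.+2) \sum_(1 <= j < (s.+1 - s2).+1)
      sign R (maltese a 1 (r + j).-1 + mdeg m) *:
      bimod_mu (slice a 1 r) m
               (slice a r.+1 (r + j).-1 ++
                mu_homog (@ainf_mu R A) (slice a (r + j) (r + j + s2).-1) ::
                slice a (r + j + s2) (r + s)) d
    = 0
}.

Section HochschildChains.
Variables (R : comPzRingType) (A : ainf_algebra R) (M : ainf_bimodule A).

Let mu := mu_homog (@ainf_mu R A).
Let muM := muM_homog (@bimod_mu R A M).

(* [CH_*(A;M)] is presented by the generators [m \otimes a_1 \otimes ... \otimes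
   a_n] with homogeneous entries, modulo linearity in each entry. *)
Definition chain_gen : choiceType :=
  (homogeneous M * seq (homogeneous A))%type.

Definition tensor_relations : set (free_module R chain_gen) :=
  [set y |
    (exists j a (x x' : M j) s,
       y = free_gen R ((homog (a *: x + x'), s) : chain_gen) -
           (a *: free_gen R ((homog x, s) : chain_gen) +
            free_gen R ((homog x', s) : chain_gen)))
    \/
    (exists m s1 j a (x x' : A j) s2,
       y = free_gen R ((m, s1 ++ homog (a *: x + x') :: s2) : chain_gen) -
           (a *: free_gen R ((m, s1 ++ homog x :: s2) : chain_gen) +
            free_gen R ((m, s1 ++ homog x' :: s2) : chain_gen)))].

Definition chains : lmodType R :=
  quotient_module (submodule_span tensor_relations).

Definition tensor (m : homogeneous M) (s : seq (homogeneous A)) : chains :=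
  quotient_class (submodule_span tensor_relations)
    (free_gen R ((m, s) : chain_gen)).

Definition tensor_degree (m : homogeneous M) (s : seq (homogeneous A)) : int :=
  (size s)%:Z - mdeg m - total_degree s.

Definition chain_degree (n : int) : submodule chains :=
  submodule_span
    [set c | exists m s, tensor_degree m s = n /\ c = tensor m s].

Definition length_filtration (p n : int) : submodule chains :=
  submodule_span
    [set c | exists m s, [/\ ((size s)%:Z <= p)%R, tensor_degree m s = n
                           & c = tensor m s]].

Definition maltese0 (m : homogeneous M) (s : seq (homogeneous A)) (i : nat) :
    int :=
  mdeg m + maltese s 1 i.

Definition hochschild_tensor (m : homogeneous M) (s : seq (homogeneous A)) :
    chains :=
  let n := size s in
  \sum_(1 <= l < n.+2)
    (tensor (muM [::] m (slice s 1 l.-1)) (slice s l n)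
     + \sum_(1 <= i < (n.+1 - l).+1)
         sign R (maltese0 m s i.-1) *:
         tensor m (slice s 1 i.-1 ++
                   mu (slice s i (i + l).-1) :: slice s (i + l) n)
     + \sum_((n.+2 - l)%N <= i < n.+1)
         sign R (maltese0 m s i.-1 * maltese s i n) *:
         tensor (muM (slice s i n) m (slice s 1 (i + l - n.+2)))
                (slice s (i + l - n.+1) i.-1)).


(* [hochschild_tensor] is linear in each entry, hence extends to the chains. *)
Definition multilinear (V : lmodType R)
    (phi : homogeneous M -> seq (homogeneous A) -> V) : Prop :=
  (forall s j, linear (fun x : M j => phi (homog x) s)) /\
  (forall m s1 s2 j, linear (fun x : A j => phi m (s1 ++ homog x :: s2))).

Lemma tensor_multilinear : multilinear tensor.
Proof.
split=> [s j|m s1 s2 j] a x x'; rewrite /tensor -linearP;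
  apply/quotient_classP => W; apply.
- by left; exists j, a, x, x', s.
- by right; exists m, s1, j, a, x, x', s2.
Qed.

Section Lift.
Variables (V : lmodType R).
Variable phi : homogeneous M -> seq (homogeneous A) -> V.
Hypothesis phi_lin : multilinear phi.

Definition chain_lift_fun (c : chains) : V :=
  free_lift (fun g : chain_gen => phi g.1 g.2) (quotient_repr c).

Fact chain_lift_class f :
  chain_lift_fun (quotient_class _ f) =
  free_lift (fun g : chain_gen => phi g.1 g.2) f.
Proof.
apply/eqP; rewrite -subr_eq0 /chain_lift_fun -raddfB; apply/eqP.
have /quotient_classP := quotient_reprK
  (quotient_class (submodule_span tensor_relations) f).
move/(_ (submodule_ker (free_lift (fun g : chain_gen => phi g.1 g.2)))).
apply=> y [[j [a [x [x' [s ->]]]]]|[m [s1 [j [a [x [x' [s2 ->]]]]]]]] /=.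
  rewrite linearB linearP /= !free_lift_gen /=.
  by rewrite (phi_lin.1 s j a x x') subrr.
rewrite linearB linearP /= !free_lift_gen /=.
by rewrite (phi_lin.2 m s1 s2 j a x x') subrr.
Qed.

Fact chain_lift_linear : linear chain_lift_fun.
Proof.
move=> a c c'; rewrite -[c]quotient_reprK -[c']quotient_reprK -linearP.
by rewrite !chain_lift_class linearP.
Qed.

Definition chain_lift : {linear chains -> V} :=
  HB.pack_for {linear chains -> V} chain_lift_fun
    (GRing.isLinear.Build R chains V *:%R chain_lift_fun chain_lift_linear).

Lemma chain_lift_tensor m s : chain_lift (tensor m s) = phi m s.
Proof. by rewrite /= /tensor chain_lift_class free_lift_gen. Qed.

End Lift.

Section Multilinearity.

Lemma eq_linear (U V : lmodType R) (f g : U -> V) :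
  f =1 g -> linear g -> linear f.
Proof. by move=> fg gl a x y; rewrite !fg gl. Qed.

Lemma linear_add (U V : lmodType R) (f g : U -> V) :
  linear f -> linear g -> linear (fun x => f x + g x).
Proof. by move=> fl gl a x y; rewrite fl gl scalerDr addrACA. Qed.

Lemma linear_scale (U V : lmodType R) (f : U -> V) (c : R) :
  linear f -> linear (fun x => c *: f x).
Proof.
by move=> fl a x y; rewrite fl scalerDr !scalerA [c * a]mulrC.
Qed.

Lemma linear_sum_nat (U V : lmodType R) (m n : nat) (f : nat -> U -> V) :
  (forall i, (m <= i < n)%N -> linear (f i)) ->
  linear (fun x => \sum_(m <= i < n) f i x).
Proof.
move=> fl a x y; rewrite scaler_sumr -big_split /=.
by apply: eq_big_nat => i /fl ->.
Qed.

Lemma linear_homog_mu s1 s2 j (U : lmodType R)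
    (f : homogeneous A -> U) :
  (forall d, linear (fun x : A d => f (homog x))) ->
  linear (fun x : A j => f (mu (s1 ++ homog x :: s2))).
Proof.
move=> fl; set e := total_degree (s1 ++ homog (0 : A j) :: s2) + 2
                    - (size (s1 ++ homog (0 : A j) :: s2))%:Z.
apply: (@eq_linear _ _ _
  (fun x : A j => f (homog (ainf_mu (s1 ++ homog x :: s2) e)))) => [x|a x y].
  rewrite /mu /mu_homog; do 3 f_equal.
  by rewrite /e /total_degree !big_cat !big_cons !size_cat.
by rewrite ainf_mu_linear fl.
Qed.

Lemma linear_homog_muMl s1 s2 m t j (U : lmodType R)
    (f : homogeneous M -> U) :
  (forall d, linear (fun x : M d => f (homog x))) ->
  linear (fun x : A j => f (muM (s1 ++ homog x :: s2) m t)).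
Proof.
move=> fl; set e := total_degree (s1 ++ homog (0 : A j) :: s2) + mdeg m
  + total_degree t + 1 - (size (s1 ++ homog (0 : A j) :: s2))%:Z - (size t)%:Z.
apply: (@eq_linear _ _ _
  (fun x : A j => f (homog (bimod_mu (s1 ++ homog x :: s2) m t e))))
  => [x|a x y].
  rewrite /muM /muM_homog; do 3 f_equal.
  by rewrite /e /total_degree !big_cat !big_cons !size_cat.
by rewrite bimod_mu_linearl fl.
Qed.

Lemma linear_homog_muMm s t j (U : lmodType R) (f : homogeneous M -> U) :
  (forall d, linear (fun x : M d => f (homog x))) ->
  linear (fun x : M j => f (muM s (homog x) t)).
Proof.
move=> fl a x y.
rewrite -(fl (total_degree s + j + total_degree t
              + 1 - (size s)%:Z - (size t)%:Z)).
by rewrite -bimod_mu_linearm.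
Qed.

Lemma linear_homog_muMr s m t1 t2 j (U : lmodType R)
    (f : homogeneous M -> U) :
  (forall d, linear (fun x : M d => f (homog x))) ->
  linear (fun x : A j => f (muM s m (t1 ++ homog x :: t2))).
Proof.
move=> fl; set e := total_degree s + mdeg m
  + total_degree (t1 ++ homog (0 : A j) :: t2) + 1 - (size s)%:Z
  - (size (t1 ++ homog (0 : A j) :: t2))%:Z.
apply: (@eq_linear _ _ _
  (fun x : A j => f (homog (bimod_mu s m (t1 ++ homog x :: t2) e))))
  => [x|a x y].
  rewrite /muM /muM_homog; do 3 f_equal.
  by rewrite /e /total_degree !big_cat !big_cons !size_cat.
by rewrite bimod_mu_linearr fl.
Qed.

Lemma slice_in (T : Type) (s1 s2 : seq T) (x : T) i j :
  (0 < i)%N -> (i <= (size s1).+1 <= j)%N ->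
  slice (s1 ++ x :: s2) i j =
  drop i.-1 s1 ++ x :: take (j - (size s1).+1) s2.
Proof.
move=> i0 /andP [ik kj]; rewrite /slice take_cat ltnNge (ltnW kj) /=.
case E : (j - size s1)%N => [|e]; first by move: kj; rewrite -subn_gt0 E.
rewrite drop_cat.
have -> : (j - (size s1).+1 = e)%N by rewrite subnS E.
case: ltnP => // ki; have -> : i.-1 = size s1.
  by apply/eqP; rewrite eqn_leq ki andbT -ltnS prednK.
by rewrite subnn drop0 drop_size.
Qed.

Lemma slice_out (T : Type) (s1 s2 : seq T) (x y : T) i j :
  (0 < i)%N -> ~~ (i <= (size s1).+1 <= j)%N ->
  slice (s1 ++ x :: s2) i j = slice (s1 ++ y :: s2) i j.
Proof.
move=> i0; rewrite negb_and -!ltnNge /slice => ijk.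
have [jk|kj] := leqP j (size s1); first by rewrite !takel_cat.
have {ijk} ki : (size s1 < i.-1)%N.
  case/orP: ijk => [h|]; last by rewrite ltnS leqNgt kj.
  by rewrite -ltnS prednK.
rewrite !take_cat ltnNge (ltnW kj) /= !drop_cat ltnNge (ltnW ki) /=.
case: (j - size s1)%N => [//|e] /=.
by case E : (i.-1 - size s1)%N => //; move: ki; rewrite -subn_gt0 E.
Qed.

Lemma maltese_homog (s1 s2 : seq (homogeneous A)) j (x y : A j) i k :
  maltese (s1 ++ homog x :: s2) i k = maltese (s1 ++ homog y :: s2) i k.
Proof.
rewrite /maltese -!(big_map (@mdeg R A) predT (fun z => z - 1)) /slice.
by rewrite !map_drop !map_take !map_cat.
Qed.

Lemma maltese0_homog m (s1 s2 : seq (homogeneous A)) j (x y : A j) i :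
  maltese0 m (s1 ++ homog x :: s2) i = maltese0 m (s1 ++ homog y :: s2) i.
Proof. by rewrite /maltese0 (maltese_homog s1 s2 x y). Qed.

Lemma hochschild_tensor_multilinear : multilinear hochschild_tensor.
Proof.
have [tm ta] := tensor_multilinear.
split=> [s j|m s1 s2 j].
  apply: linear_sum_nat => l _; apply: linear_add; [apply: linear_add|].
  - exact: (linear_homog_muMm [::] (slice s 1 l.-1)
             (f := tensor^~ (slice s l (size s)))).
  - by apply: linear_sum_nat => i _; apply: linear_scale; exact: tm.
  - apply: linear_sum_nat => i _; apply: linear_scale.
    exact: (linear_homog_muMm (slice s i (size s))
             (slice s 1 (i + l - (size s).+2))
             (f := tensor^~ (slice s (i + l - (size s).+1) i.-1))).
pose S x := s1 ++ homog (x : A j) :: s2.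
pose n := size (S 0); pose k := (size s1).+1.
have Sn x : size (S x) = n by rewrite /n /S !size_cat.
have kn : (k <= n)%N by rewrite /n /S size_cat /= addnS ltnS leq_addr.
have sin i e (x : A j) : (0 < i)%N -> (i <= k <= e)%N ->
  slice (S x) i e = drop i.-1 s1 ++ homog x :: take (e - k) s2.
  exact: slice_in.
have sout i e (x : A j) : (0 < i)%N -> ~~ (i <= k <= e)%N ->
  slice (S x) i e = slice (S 0) i e.
  exact: slice_out.
rewrite /hochschild_tensor.
apply: (@eq_linear _ _ _ (fun x => \sum_(1 <= l < n.+2)
    (tensor (muM [::] m (slice (S x) 1 l.-1)) (slice (S x) l n)
     + \sum_(1 <= i < (n.+1 - l).+1)
         sign R (maltese0 m (S 0) i.-1) *:
         tensor m (slice (S x) 1 i.-1 ++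
                   mu (slice (S x) i (i + l).-1) :: slice (S x) (i + l) n)
     + \sum_((n.+2 - l)%N <= i < n.+1)
         sign R (maltese0 m (S 0) i.-1 * maltese (S 0) i n) *:
         tensor (muM (slice (S x) i n) m (slice (S x) 1 (i + l - n.+2)))
                (slice (S x) (i + l - n.+1) i.-1)))) => [x|].
  rewrite -/(S x) Sn; apply: eq_bigr => l _; congr (_ + _ + _).
    by apply: eq_bigr => i _; rewrite (maltese0_homog _ _ _ x 0).
  apply: eq_bigr => i _.
  by rewrite (maltese0_homog _ _ _ x 0) (maltese_homog _ _ x 0).
apply: linear_sum_nat => l /andP [l0 ln].
apply: linear_add; [apply: linear_add|].
- have [kl|lk] := leqP k l.-1.
    apply: (@eq_linear _ _ _ (fun x => tensor
      (muM [::] m (drop 0 s1 ++ homog x :: take (l.-1 - k) s2))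
      (slice (S 0) l n))) => [x|].
      rewrite sin // (sout l) // negb_and -ltnNge.
      by rewrite -(prednK l0) ltnS kl.
    exact: (linear_homog_muMr _ _ _ _
             (f := tensor^~ (slice (S 0) l n))).
  apply: (@eq_linear _ _ _ (fun x => tensor
      (muM [::] m (slice (S 0) 1 l.-1))
      (drop l.-1 s1 ++ homog x :: take (n - k) s2))) => [x|].
    rewrite (sin l) //; last by rewrite kn andbT -(prednK l0).
    by rewrite (sout 1%N) // negb_and -!ltnNge lk orbT.
  exact: ta.
- apply: linear_sum_nat => i /andP [i0 iln]; apply: linear_scale.
  have [ki|ik] := ltnP k i.
    apply: (@eq_linear _ _ _ (fun x => tensor m
      ((drop 0 s1 ++ homog x :: take (i.-1 - k) s2) ++
       mu (slice (S 0) i (i + l).-1) :: slice (S 0) (i + l) n))) => [x|].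
      rewrite (sin 1%N) //; last by rewrite /= -ltnS prednK.
      rewrite (sout i) // ?negb_and -?ltnNge ?ki //.
      by rewrite (sout (i + l)%N) ?addn_gt0 ?i0 // negb_and -ltnNge ltn_addr.
    under eq_fun do rewrite -catA /=.
    exact: ta.
  have [kil|ilk] := leqP (i + l) k.
    apply: (@eq_linear _ _ _ (fun x => tensor m
      (slice (S 0) 1 i.-1 ++ mu (slice (S 0) i (i + l).-1) ::
       drop (i + l).-1 s1 ++ homog x :: take (n - k) s2))) => [x|].
      rewrite (sin (i + l)%N) ?addn_gt0 ?i0 ?kil //.
      rewrite (sout 1%N) // 1?negb_and -?ltnNge; last first.
        by rewrite prednK // ik orbT.
      rewrite (sout i) // negb_and -!ltnNge prednK ?addn_gt0 ?i0 //.
      by rewrite kil orbT.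
    under eq_fun do rewrite -cat_cons catA.
    exact: ta.
  apply: (@eq_linear _ _ _ (fun x => tensor m
    (slice (S 0) 1 i.-1 ++
     mu (drop i.-1 s1 ++ homog x :: take ((i + l).-1 - k) s2) ::
     slice (S 0) (i + l) n))) => [x|].
    rewrite (sin i) ?ik //=; last first.
      by rewrite -ltnS prednK ?addn_gt0 ?i0.
    rewrite (sout 1%N) // 1?negb_and -?ltnNge; last first.
      by rewrite prednK // ik orbT.
    by rewrite (sout (i + l)%N) ?addn_gt0 ?i0 // negb_and -ltnNge ilk.
  apply: (linear_homog_mu _ _ (f := fun y => tensor m
    (slice (S 0) 1 i.-1 ++ y :: slice (S 0) (i + l) n))) => d.
  exact: ta.
- apply: linear_sum_nat => i /andP [nli iln]; apply: linear_scale.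
  have i0 : (0 < i)%N by apply: leq_trans nli; rewrite subn_gt0.
  have il : (n.+2 <= i + l)%N by rewrite addnC -leq_subLR.
  have il1 : (i + l - n.+1 = (i + l - n.+2).+1)%N.
    by rewrite [RHS]subnSK.
  have ile : (i + l - n.+2 < i)%N.
    by rewrite ltn_subLR // addnC ltn_add2r.
  rewrite il1; set e := (i + l - n.+2)%N in ile *.
  have [ik|ki] := leqP i k.
    apply: (@eq_linear _ _ _ (fun x => tensor
      (muM (drop i.-1 s1 ++ homog x :: take (n - k) s2) m (slice (S 0) 1 e))
      (slice (S 0) e.+1 i.-1))) => [x|].
      rewrite (sin i) ?ik //.
      rewrite (sout 1%N) // 1?negb_and -?ltnNge ?(leq_trans ile) ?orbT //.
      by rewrite (sout e.+1) // negb_and -!ltnNge prednK // ik orbT.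
    exact: (linear_homog_muMl _ _ _ _
             (f := tensor^~ (slice (S 0) e.+1 i.-1))).
  have [ke|ek] := leqP k e.
    apply: (@eq_linear _ _ _ (fun x => tensor
      (muM (slice (S 0) i n) m (drop 0 s1 ++ homog x :: take (e - k) s2))
      (slice (S 0) e.+1 i.-1))) => [x|].
      rewrite (sin 1%N) ?ke // (sout i) // 1?negb_and -?ltnNge ?ki //.
      by rewrite (sout e.+1) // negb_and -!ltnNge ltnS ke.
    exact: (linear_homog_muMr _ _ _ _
             (f := tensor^~ (slice (S 0) e.+1 i.-1))).
  apply: (@eq_linear _ _ _ (fun x => tensor
    (muM (slice (S 0) i n) m (slice (S 0) 1 e))
    (drop e s1 ++ homog x :: take (i.-1 - k) s2))) => [x|].
    rewrite (sin e.+1) ?ek //=; last by rewrite -ltnS prednK.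
    rewrite (sout i) // 1?negb_and -?ltnNge ?ki //.
    by rewrite (sout 1%N) // negb_and -!ltnNge ek orbT.
  exact: ta.
Qed.

End Multilinearity.

Definition hochschild_b : {linear chains -> chains} :=
  chain_lift hochschild_tensor_multilinear.

Lemma hochschild_bE m s : hochschild_b (tensor m s) = hochschild_tensor m s.
Proof. exact: chain_lift_tensor. Qed.

End HochschildChains.

(* When [A] and [M] are concentrated in nonnegative degrees, the pages of the
   spectral sequence of the length filtration vanish outside the quadrant
   [p >= 0], [q <= 0], so that truncating to this quadrant changes nothing.
   In general elements of negative internal degree lie in [q > 0], and the
   truncated pages would miss them. *)
Section Quadrant.
Variables (R : comPzRingType) (A : ainf_algebra R) (M : ainf_bimodule A).
Hypothesis A_nonneg : forall j, (j < 0)%R -> forall x : A j, x = 0.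
Hypothesis M_nonneg : forall j, (j < 0)%R -> forall x : M j, x = 0.

Fact linear_at0 (U V : lmodType R) (f : U -> V) : linear f -> f 0 = 0.
Proof.
by move=> /(_ (-1) 0 0); rewrite scaler0 addr0 scaleN1r addNr.
Qed.

Lemma tensor_negative (m : homogeneous M) (s : seq (homogeneous A)) :
  (mdeg m + total_degree s < 0)%R -> tensor m s = 0.
Proof.
move=> neg; have [tm ta] := tensor_multilinear M.
have [m0|m0] := ltrP (mdeg m) 0.
  case: m m0 {neg} => j x /= j0; rewrite (M_nonneg j0 x).
  exact: (linear_at0 (tm s j)).
have : has (fun a => mdeg a < 0)%R s.
  apply/negPn/negP; rewrite -all_predC => /allP s0.
  move: neg; rewrite ltNge addr_ge0 // /total_degree big_seq sumr_ge0 // => a.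
  by move/s0; rewrite /= -leNgt.
case/hasP => a /path.splitPr [s1 s2].
case: a => j x /= j0; rewrite (A_nonneg j0 x).
exact: (linear_at0 (ta m s1 s2 j)).
Qed.

Lemma length_filtration_outside p n c :
  (p < 0)%R \/ (p < n)%R -> length_filtration M p n c -> c = 0.
Proof.
move=> out /(_ (submodule_ker (@idfun (chains M)))); apply.
move=> _ [m [s [sp degn ->]]] /=; apply: tensor_negative.
case: out => [p0|pn].
  by move: (le_lt_trans sp p0); rewrite ltNge.
move: (le_lt_trans sp pn); rewrite -degn /tensor_degree -addrA -opprD.
by rewrite ltrDl oppr_gt0.
Qed.

Lemma page_outside r p q
    (c : page (length_filtration M) (hochschild_b M) r p q) :
  (p < 0)%R \/ (0 < q)%R -> c = 0.
Proof.
move=> out; rewrite -[c]quotient_reprK; set x := quotient_repr c.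
rewrite -[RHS](raddf0 (quotient_class _)); congr quotient_class.
apply: val_inj; have [Fx _] := submodule_elt_in x.
rewrite [LHS](length_filtration_outside _ Fx) //.
by case: out => [|q0]; [left|right; rewrite ltrDl].
Qed.

End Quadrant.

(* Main.v *)
Require Import Defs.
From HB Require Import structures.
From mathcomp Require Import all_boot all_order all_algebra.
From mathcomp Require Import finmap.
From mathcomp Require Import boolp functions.
From mathcomp Require Import zify.

Set Implicit Arguments.
Unset Strict Implicit.
Unset Printing Implicit Defensive.

Import GRing.Theory Num.Theory Order.TTheory.
Local Open Scope ring_scope.

(** The statement splits into a general fact and a computation.

    The general fact: a filtered complex has a spectral sequence, and if the
    filtration is exhaustive and vanishes in negative filtration degrees, then
    the spectral sequence converges. This is the usual diagram chase:
    [d [x] = [b x]] on [Z^r / (Z^{r-1}_{p-1} + B^{r-1})], and the maps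
    sending the class of [x] to the class of [x] identify [E^{r+1}] with the
    homology of [E^r] ([next_page_bijective]) and the limit page with the
    associated graded module of the homology ([limit_map_bijective]). Boundedness below makes
    [Z^r_p] equal to the cycles as soon as [r > p], and exhaustiveness makes
    every boundary lie in some [B^r].

    The computation: [b] lowers the degree, preserves the length filtration,
    and squares to zero. The last point is organised by regarding
    [m, a_1, ..., a_n] as a cyclic word with exactly one letter from [M], of
    parity [mu(m)], and the other letters from [A], of parity [||a||]. The
    operations [mu] and [mu^M] become one odd operation [word_op] that turns a
    word with at most one module letter into a letter, the defining relations
    of [A] and of [M] become one relation ([word_op_relation]), and a word
    determines a chain up to the Koszul sign of a rotation
    ([word_tensor_cat]). In these terms [b] is the sum over all rotations of
    the word, with Koszul signs, and over all nonempty prefixes, of the result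
    of replacing the prefix by the value of the operation on it
    ([hochschild_tensor_cyclic]).

    In [b (b w)] two subwords are contracted in turn. Either the second one
    avoids the letter created by the first contraction; contracting the same
    two disjoint subwords in the other order gives the opposite term since the
    operation is odd ([cyclic_disjoint_pairs]). Or it contains that letter; the
    terms with a fixed outer subword add up to the structure relation
    ([cyclic_nested_pairs]). Dividing the disjoint pairs into two halves that
    the exchange of the two contractions interchanges, so that nothing has to
    be divided by 2, is done by the position of the unique module letter. *)

(** * Linear maps between subquotients *)
Section LinearMaps.
Variable R : pzRingType.

Lemma linear_bijective (U V : lmodType R) (f : {linear U -> V}) :
  (forall x, f x = 0 -> x = 0) -> (forall y, exists x, f x = y) ->
  bijective f.
Proof.
move=> finj fsurj; have [g gK] := boolp.choice fsurj.
exists g => // x; apply/eqP; rewrite -subr_eq0; apply/eqP/finj.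
by rewrite linearB /= gK subrr.
Qed.

Definition linear_bundle (U V : lmodType R) (f : U -> V) (fl : linear f) :
    {linear U -> V} :=
  HB.pack_for {linear U -> V} f (GRing.isLinear.Build R U V *:%R f fl).

Lemma linear_zero (U V : lmodType R) (f : U -> V) : linear f -> f 0 = 0.
Proof. by move=> fl; rewrite -[LHS]/(linear_bundle fl _) raddf0. Qed.

Section Corestriction.
Variables (U V : lmodType R) (f : {linear U -> V}) (W : submodule V).
Hypothesis fW : forall x, W (f x).

Definition corestrict_fun (x : U) : submodule_elt W :=
  SubmoduleElt (submodule_in (fW x)).

Fact corestrict_linear : linear corestrict_fun.
Proof. by move=> a x y; apply: val_inj; rewrite /= !linearP. Qed.

Definition corestrict : {linear U -> submodule_elt W} :=
  HB.pack_for {linear U -> submodule_elt W} corestrict_fun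
    (GRing.isLinear.Build R U (submodule_elt W) *:%R corestrict_fun
      corestrict_linear).

End Corestriction.

Section QuotientLift.
Variables (U V : lmodType R) (W : submodule U) (f : {linear U -> V}).
Hypothesis fW0 : forall x, W x -> f x = 0.

Definition quotient_lift_fun (c : quotient_module W) : V := f (quotient_repr c).

Lemma quotient_lift_class x : quotient_lift_fun (quotient_class W x) = f x.
Proof.
apply/eqP; rewrite -subr_eq0 -linearB; apply/eqP/fW0.
by apply/quotient_classP; rewrite quotient_reprK.
Qed.

Fact quotient_lift_linear : linear quotient_lift_fun.
Proof.
move=> a c d; rewrite -[c]quotient_reprK -[d]quotient_reprK -linearP.
by rewrite !quotient_lift_class linearP.
Qed.

Definition quotient_lift : {linear quotient_module W -> V} :=
  HB.pack_for {linear quotient_module W -> V} quotient_lift_fun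
    (GRing.isLinear.Build R (quotient_module W) V *:%R quotient_lift_fun
      quotient_lift_linear).

End QuotientLift.

Section SubmoduleOperations.
Variables (V : lmodType R) (W1 W2 : submodule V).

Lemma submodule_addl x : W1 x -> submodule_add W1 W2 x.
Proof.
by move=> Wx; exists x, 0; rewrite addr0; split=> //; exact: submodule0.
Qed.

Lemma submodule_addr x : W2 x -> submodule_add W1 W2 x.
Proof.
by move=> Wx; exists 0, x; rewrite add0r; split=> //; exact: submodule0.
Qed.

Lemma submoduleD (W : submodule V) x y : W x -> W y -> W (x + y).
Proof. by move=> Wx Wy; rewrite -[x]scale1r; exact: submoduleL. Qed.

Lemma submoduleB (W : submodule V) x y : W x -> W y -> W (x - y).
Proof. by move=> Wx Wy; rewrite -scaleN1r addrC; exact: submoduleL. Qed.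

Lemma submodule_sum (W : submodule V) (I : Type) (r : seq I)
    (P : pred I) (f : I -> V) :
  (forall i, P i -> W (f i)) -> W (\sum_(i <- r | P i) f i).
Proof.
by move=> Wf; elim/big_ind: _ => //; [exact: submodule0|exact: submoduleD].
Qed.

End SubmoduleOperations.

Fact submodule_preim_subproof (U V : lmodType R) (f : {linear U -> V})
    (W : submodule V) : is_submodule (fun x => W (f x)).
Proof.
split; first by rewrite linear0; exact: submodule0.
by move=> a x y Wx Wy; rewrite linearP; exact: submoduleL.
Qed.

Definition submodule_preim (U V : lmodType R) (f : {linear U -> V})
    (W : submodule V) : submodule U :=
  Submodule (submodule_preim_subproof f W).

Section SubquotientTheory.
Variables (V : lmodType R) (Z B : submodule V).

Lemma subquotient_class_eq x y (Zx : Z x) (Zy : Z y) :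
  subquotient_class B Zx = subquotient_class B Zy <-> B (x - y).
Proof. by rewrite /subquotient_class quotient_classP /=. Qed.

Lemma subquotient_class_eq0 x (Zx : Z x) :
  subquotient_class B Zx = 0 <-> B x.
Proof.
rewrite -[0](linear0 (quotient_class (submodule_restr Z B))).
by rewrite /subquotient_class quotient_classP subr0 /=.
Qed.

Lemma subquotient_repr (c : subquotient Z B) :
  exists x (Zx : Z x), c = subquotient_class B Zx.
Proof.
pose x := quotient_repr c; exists (val x), (submodule_elt_in x).
rewrite -[LHS]quotient_reprK; congr quotient_class; exact: val_inj.
Qed.

Lemma subquotient_class_congr x y (Zx : Z x) (Zy : Z y) :
  x = y -> subquotient_class B Zx = subquotient_class B Zy.
Proof.
by move=> xy; apply/subquotient_class_eq; rewrite xy subrr; exact: submodule0.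
Qed.

Variables (W : lmodType R) (f : {linear submodule_elt Z -> W}).
Hypothesis f0 : forall x, B (val x) -> f x = 0.

Definition subquotient_lift : {linear subquotient Z B -> W} :=
  @quotient_lift _ _ (submodule_restr Z B) f f0.

Lemma subquotient_liftE x (Zx : Z x) :
  subquotient_lift (subquotient_class B Zx) =
  f (SubmoduleElt (submodule_in Zx)).
Proof. exact: (@quotient_lift_class _ _ (submodule_restr Z B) f f0). Qed.

End SubquotientTheory.
Lemma free_module_gen (G : choiceType) (f : free_module R G) (X : {fset G}) :
  (forall g, g \notin X -> val f g = 0) ->
  f = \sum_(g <- X) (val f g : R) *: free_gen R g.
Proof.
move=> f0; apply: val_inj; apply/funext => h.
rewrite raddf_sum fct_sumE.
transitivity (\sum_(g <- X) (val f g : R) * (h == g)%:R); last first.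
  exact: eq_bigr.
have [hX|hX] := boolP (h \in X); last first.
  rewrite f0 // big_seq big1 // => g gX; case: eqVneq => [hg|_].
    by rewrite hg gX in hX.
  by rewrite mulr0.
rewrite (bigD1_seq h) //= eqxx mulr1 big1 ?addr0 // => g /negPf gh.
by rewrite eq_sym gh mulr0.
Qed.

End LinearMaps.

(** * The spectral sequence of a filtered complex *)
Section FilteredComplexTheory.
Variables (R : pzRingType) (C : lmodType R).
Variables (Cn : int -> submodule C) (F : int -> int -> submodule C).
Variable b : {linear C -> C}.
Hypothesis bF : forall p n x, F p n x -> F p (n - 1) (b x).
Hypothesis FS : forall (p n : int) x, F (p - 1) n x -> F p n x.
Hypothesis bb : forall x, b (b x) = 0.

Lemma filtration_index p n p' n' x : F p n x -> p = p' -> n = n' -> F p' n' x.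
Proof. by move=> Fx <- <-. Qed.

Lemma filtration_mono p (k : nat) n x : F p n x -> F (p + k%:Z) n x.
Proof.
move=> Fx; elim: k => [|k IH]; first by rewrite addr0.
by apply: FS; apply: filtration_index IH _ _ => //; lia.
Qed.

Local Notation Zr := (Zr F b).
Local Notation Br := (Br F b).
Local Notation Zoo := (Zoo F b).
Local Notation page_zero := (page_zero F b).

Section Differential.
Variables (r : nat) (p q p' q' : int).
Hypotheses (ep : p' = p - r%:Z) (eq : q' = q + r%:Z - 1).

Lemma Zr_differential x : Zr r p q x -> Zr r p' q' (b x).
Proof.
case=> _ Fbx; split; last by rewrite bb; exact: submodule0.
by apply: filtration_index Fbx _ _; lia.
Qed.

(** In [x = y + z] with [y] from [Z^{r-1}_{p-1}] and [z] a boundary, only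
    [b y] survives, and it is a boundary from filtration degree [p - 1], which
    is what [B^{r-1}] allows at the target. *)
Lemma page_zero_differential x :
  page_zero r p q x -> page_zero r p' q' (b x).
Proof.
case: r ep eq => [|s] eps eqs.
  by move/bF=> Fbx; apply: filtration_index Fbx _ _; lia.
case=> y [z [[Fy Fby] [Fz [w [_ zE]]] ->]].
rewrite linearD zE bb addr0; apply: submodule_addr; split.
  by apply: filtration_index Fby _ _; lia.
by exists y; split=> //; apply: filtration_index Fy _ _; lia.
Qed.

Fact page_map_subproof (x : submodule_elt (Zr r p q)) : Zr r p' q' (b (val x)).
Proof. exact: Zr_differential (submodule_elt_in x). Qed.

Definition page_map :
    {linear submodule_elt (Zr r p q) -> page F b r p' q'} :=
  quotient_class (submodule_restr (Zr r p' q') (page_zero r p' q')) \o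
  corestrict (f := b \o val) page_map_subproof.

Fact page_map0 x : page_zero r p q (val x) -> page_map x = 0.
Proof. by move/page_zero_differential=> bx; apply/subquotient_class_eq0. Qed.

Definition page_differential : {linear page F b r p q -> page F b r p' q'} :=
  subquotient_lift page_map0.

Lemma page_differentialE x (Zx : Zr r p q x) (Zbx : Zr r p' q' (b x)) :
  page_differential (page_class Zx) = page_class Zbx.
Proof.
by rewrite /page_differential subquotient_liftE; exact: subquotient_class_congr.
Qed.

End Differential.

Definition induced_differentials : page_differentials F b :=
  fun r p q p' q' ep eq => page_differential ep eq.

Section NextPage.
Variables (r : nat) (p q : int).

Local Notation dout := (d_out induced_differentials r p q).
Local Notation din := (d_in induced_differentials r p q).

Lemma Zr_succ x : Zr r.+1 p q x -> Zr r p q x.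
Proof.
case=> Fx Fbx; split=> //; apply: FS.
by apply: filtration_index Fbx _ _; lia.
Qed.

Lemma d_out_class x (Zx : Zr r p q x) :
  dout (page_class Zx) = 0 <->
  page_zero r (p - r%:Z) (q + r%:Z - 1) (b x).
Proof.
rewrite /d_out /induced_differentials.
rewrite (page_differentialE _ _ Zx (Zr_differential (erefl _) (erefl _) Zx)).
exact: subquotient_class_eq0.
Qed.

Lemma d_in_range x (Zx : Zr r p q x) :
  submodule_range din (page_class Zx) <->
  exists y, [/\ F (p + r%:Z) (p + q + 1) y, F p (p + q) (b y)
              & page_zero r p q (x - b y)].
Proof.
split=> [[c cE]|[y [Fy Fby Pxy]]].
  have [y [Zy yE]] := subquotient_repr c; exists y.
  have Zby := Zr_differential (incoming_p r p) (incoming_q r q) Zy.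
  case: (Zy) => Fy Fby; split.
  - by apply: filtration_index Fy _ _; lia.
  - by apply: filtration_index Fby _ _; lia.
  apply/(subquotient_class_eq _ Zx Zby); rewrite -/(page_class Zx) cE yE.
  exact: page_differentialE.
have Zy : Zr r (p + r%:Z) (q - r%:Z + 1) y.
  split; first by apply: filtration_index Fy _ _; lia.
  by apply: filtration_index Fby _ _; lia.
exists (page_class Zy).
have Zby := Zr_differential (incoming_p r p) (incoming_q r q) Zy.
rewrite (page_differentialE _ _ Zy Zby).
exact/subquotient_class_eq.
Qed.

Lemma Zr_succ_kernel x : Zr r.+1 p q x ->
  page_zero r (p - r%:Z) (q + r%:Z - 1) (b x).
Proof.
case=> Fx Fbx; case: r Fbx => [|s] Fbx.
  by apply: filtration_index Fbx _ _; lia.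
apply: submodule_addl; split; last by rewrite bb; exact: submodule0.
by apply: filtration_index Fbx _ _; lia.
Qed.

(** The kernel of [d^r] is represented by [Z^{r+1}]: if [b x] is zero on the
    target page, then [b x = y + b w] with [y] one filtration step lower and
    [w] of filtration degree [p - 1], so that [x - w] is the required
    representative. *)
Lemma kernel_Zr_succ x : Zr r p q x ->
    page_zero r (p - r%:Z) (q + r%:Z - 1) (b x) ->
  exists2 x', Zr r.+1 p q x' & page_zero r p q (x - x').
Proof.
case=> Fx Fbx; case: r Fbx => [|s] Fbx.
  move=> bx; exists x; last by rewrite subrr; exact: submodule0.
  by split=> //; apply: filtration_index bx _ _; lia.
case=> y [z [[Fy _] [Fz [w [Fw zE]]] bxE]].
have Fw' : F (p - 1) (p + q) w by apply: filtration_index Fw _ _; lia.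
exists (x - w); last first.
  rewrite opprB addrC subrK; apply: submodule_addl.
  split; first by apply: filtration_index Fw _ _; lia.
  by rewrite -zE; apply: filtration_index Fz _ _; lia.
split; last first.
  by rewrite linearB /= bxE -zE addrK; apply: filtration_index Fy _ _; lia.
by apply: submoduleB => //; exact: FS.
Qed.

(** The kernel of [Z^{r+1} -> H(E^r)]: the right-hand side says that the class
    of [x] lies in the image of the incoming [d^r] (see [d_in_range]). *)
Lemma page_zero_succ x : Zr r.+1 p q x ->
  page_zero r.+1 p q x <->
  exists y, [/\ F (p + r%:Z) (p + q + 1) y, F p (p + q) (b y)
              & page_zero r p q (x - b y)].
Proof.
case=> Fx Fbx; split=> [[y [z [[Fy Fby] [Fz [w [Fw zE]]] xE]]]|].
  exists w; rewrite -zE; split=> //.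
  rewrite xE addrK; case: r Fby => [|s] Fby.
    by apply: filtration_index Fy _ _; lia.
  apply: submodule_addl.
  by split=> //; apply: FS; apply: filtration_index Fby _ _; lia.
case=> y [Fy Fby Pxy] /=.
have Bby : Br r p q (b y) by split=> //; exists y.
case: r Pxy Fy Bby Fbx => [|s] Pxy Fy Bby Fbx.
  exists (x - b y), (b y); rewrite subrK; split=> //; split=> /=.
    by apply: filtration_index Pxy _ _; lia.
  have -> : b (x - b y) = b x by rewrite linearB /= bb subr0.
  by apply: filtration_index Fbx _ _; lia.
case: Pxy => u [v [[Fu Fbu] [Fv [w [Fw vE]]] xE]].
have bxu : b x = b u.
  by have := congr1 b xE; rewrite linearB linearD /= vE !bb addr0 subr0.
exists u, (v + b y); split.
- by split=> //; rewrite -bxu; apply: filtration_index Fbx _ _; lia.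
- apply: (submoduleD (W := Br s.+1 p q)) => //; split=> //.
  exists w; split=> //; apply: filtration_index (filtration_mono 1 Fw) _ _; lia.
- by rewrite addrA -xE subrK.
Qed.

Fact next_page_kernel (x : submodule_elt (Zr r.+1 p q)) :
  submodule_ker dout (page_class (Zr_succ (submodule_elt_in x))).
Proof. exact/d_out_class/Zr_succ_kernel/submodule_elt_in. Qed.

Definition Zr_inclusion : {linear submodule_elt (Zr r.+1 p q) ->
    submodule_elt (Zr r p q)} :=
  corestrict (f := val) (fun x => Zr_succ (submodule_elt_in x)).

Definition next_page_cycle :=
  corestrict (f := quotient_class (submodule_restr (Zr r p q) (page_zero r p q))
                   \o Zr_inclusion) next_page_kernel.

Definition next_page_fun :
    {linear submodule_elt (Zr r.+1 p q) ->
     page_homology induced_differentials r p q} :=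
  quotient_class (submodule_restr (submodule_ker dout) (submodule_range din))
  \o next_page_cycle.

Lemma next_page_fun_eq0 x : next_page_fun x = 0 <-> page_zero r.+1 p q (val x).
Proof.
rewrite (page_zero_succ (submodule_elt_in x)).
rewrite -(d_in_range (Zr_succ (submodule_elt_in x))).
exact: subquotient_class_eq0.
Qed.

Definition next_page :
    {linear page F b r.+1 p q -> page_homology induced_differentials r p q} :=
  subquotient_lift (fun x => proj2 (next_page_fun_eq0 x)).

Lemma next_page_bijective : bijective next_page.
Proof.
apply: linear_bijective => [c|c].
  have [x [Zx ->]] := subquotient_repr c.
  rewrite /next_page subquotient_liftE => /next_page_fun_eq0 /= Px.
  exact/subquotient_class_eq0.
have [e [Ke ->]] := subquotient_repr c.
have [x [Zx eE]] := subquotient_repr e.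
have : dout (page_class Zx) = 0 by rewrite /page_class -eE.
case/d_out_class/(kernel_Zr_succ Zx) => x' Zx' Pxx'.
exists (page_class Zx'); rewrite /next_page subquotient_liftE.
apply: subquotient_class_congr; rewrite eE.
by apply/esym/subquotient_class_eq.
Qed.

End NextPage.

Lemma filtered_complex_spectral_sequence :
  is_spectral_sequence induced_differentials.
Proof.
split=> [r p q p' q' ep eq x Zx|r p q c|r p q].
- by exists (Zr_differential ep eq Zx); exact: page_differentialE.
- have [x [Zx ->]] := subquotient_repr c.
  have Zbx := Zr_differential (incoming_p r p) (incoming_q r q) Zx.
  rewrite [X in d_out _ _ _ _ X](page_differentialE _ _ Zx Zbx).
  by apply/(d_out_class Zbx); rewrite bb; exact: submodule0.
exists (next_page r p q); split; first exact: next_page_bijective.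
move=> x Zx'; have Zx := Zr_succ Zx'.
have Kx : submodule_ker (d_out induced_differentials r p q) (page_class Zx).
  exact/d_out_class/Zr_succ_kernel.
exists Zx, Kx; rewrite /next_page subquotient_liftE.
by apply: subquotient_class_congr; exact: subquotient_class_congr.
Qed.

Section Convergence.
Hypothesis F_exhaustive : forall n x, Cn n x <-> exists p, F p n x.
Hypothesis F_below : forall (p n : int) x, p < 0 -> F p n x -> x = 0.

Lemma filtration_in p n x : F p n x -> Cn n x.
Proof. by move=> Fx; apply/F_exhaustive; exists p. Qed.

(** For [r = |p| + 1] the condition on [b x] takes place in negative
    filtration degree. *)
Lemma Zoo_limit p q x : Zoo p q x <-> forall r, Zr r p q x.
Proof.
split=> [[Fx bx] r|Zx].
  by split=> //; rewrite bx; exact: submodule0.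
have [Fx Fbx] := Zx (`|p|%N.+1); split=> //.
by apply: F_below Fbx; lia.
Qed.

Lemma Boo_limit p q x : Boo Cn F b p q x <-> exists r, Br r p q x.
Proof.
split=> [[Fx [y [Cy xE]]]|[r [Fx [y [Fy xE]]]]]; last first.
  by split=> //; exists y; split=> //; exact: filtration_in Fy.
have [p' Fy] := (F_exhaustive _ _).1 Cy.
exists `|p' - p|%N; split=> //; exists y; split=> //.
set k := `|p' - p|%N.
(* [p + k] is at least [p']. *)
apply: filtration_index (filtration_mono (absz (p + k%:Z - p')%R) Fy) _ _ => //.
by lia.
Qed.

Section GradedPiece.
Variables p q : int.

Lemma Zoo_cycles x : Zoo p q x -> cycles Cn b (p + q) x.
Proof. by case=> Fx bx; split=> //; exact: filtration_in Fx. Qed.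

Lemma Zoo_homology_filtration x (Zx : Zoo p q x) :
  homology_filtration Cn F b p (p + q) (homology_class (Zoo_cycles Zx)).
Proof. by have [Fx _] := Zx; exists x, (Zoo_cycles Zx). Qed.

(** If [x] is homologous to a cycle [y] of filtration degree [p - 1], then
    [x = y + (x - y)] and [x - y] is a boundary lying in [F_p]. *)
Lemma homology_filtration_boundary x (Zx : Zoo p q x) :
  homology_filtration Cn F b (p - 1) (p + q)
    (homology_class (Zoo_cycles Zx)) <->
  submodule_add (Zoo (p - 1) (q + 1)) (Boo Cn F b p q) x.
Proof.
have [Fx bx] := Zx; split.
  case=> y [[Cy by0] [Fy /subquotient_class_eq [w [Cw xyE]]]].
  exists y, (x - y); rewrite [RHS]addrC subrK; split=> //.
    by split=> //; apply: filtration_index Fy _ _; lia.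
  split; last by exists w.
  by apply: submoduleB => //; exact: FS.
case=> y [z [[Fy by0] [Fz [w [Cw zE]]] xE]].
have Fy' : F (p - 1) (p + q) y by apply: filtration_index Fy _ _; lia.
have Cy : cycles Cn b (p + q) y by split=> //; exact: filtration_in Fy'.
exists y, Cy; split=> //; apply/subquotient_class_eq.
by exists w; split=> //; rewrite -zE xE addrC addKr.
Qed.

Definition limit_cycle : {linear submodule_elt (Zoo p q) ->
    submodule_elt (cycles Cn b (p + q))} :=
  corestrict (f := val) (fun x => Zoo_cycles (submodule_elt_in x)).

Definition limit_homology : {linear submodule_elt (Zoo p q) ->
    submodule_elt (homology_filtration Cn F b p (p + q))} :=
  corestrict (f := quotient_class
      (submodule_restr (cycles Cn b (p + q)) (boundaries Cn b (p + q)))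
      \o limit_cycle)
    (fun x => Zoo_homology_filtration (submodule_elt_in x)).

Definition limit_map_fun : {linear submodule_elt (Zoo p q) ->
    homology_graded Cn F b p (p + q)} :=
  quotient_class (submodule_restr (homology_filtration Cn F b p (p + q))
     (homology_filtration Cn F b (p - 1) (p + q))) \o limit_homology.

Lemma limit_map_fun_eq0 x :
  limit_map_fun x = 0 <->
  submodule_add (Zoo (p - 1) (q + 1)) (Boo Cn F b p q) (val x).
Proof.
rewrite -(homology_filtration_boundary (submodule_elt_in x)).
exact: subquotient_class_eq0.
Qed.

Definition limit_map :
    {linear limit_page Cn F b p q -> homology_graded Cn F b p (p + q)} :=
  subquotient_lift (fun x => proj2 (limit_map_fun_eq0 x)).

Lemma limit_map_bijective : bijective limit_map.
Proof.
apply: linear_bijective => [c|c].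
  have [x [Zx ->]] := subquotient_repr c.
  rewrite /limit_map subquotient_liftE => /limit_map_fun_eq0 /= Px.
  exact/subquotient_class_eq0.
have [e [[x [Zx [Fx eE]]] ->]] := subquotient_repr c.
have Zx' : Zoo p q x by have [_ bx] := Zx; split.
exists (limit_class Cn Zx'); rewrite /limit_map subquotient_liftE.
by apply: subquotient_class_congr; rewrite eE; exact: subquotient_class_congr.
Qed.

End GradedPiece.

Lemma filtered_complex_converges : converges_to_homology Cn F b.
Proof.
split=> [||p q|n c|n]; [exact: Zoo_limit|exact: Boo_limit|..].
- exists (limit_map p q); split; first exact: limit_map_bijective.
  move=> x Zx; exists (Zoo_cycles Zx), (Zoo_homology_filtration Zx).
  rewrite /limit_map subquotient_liftE.
  by apply: subquotient_class_congr; exact: subquotient_class_congr.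
- have [x [[Cx bx] ->]] := subquotient_repr c.
  have [p Fx] := (F_exhaustive _ _).1 Cx.
  by exists p, x, (conj Cx bx).
exists (-1) => c [x [Zx [Fx ->]]]; apply/subquotient_class_eq0.
by rewrite (F_below _ Fx) //; exact: submodule0.
Qed.

End Convergence.
End FilteredComplexTheory.

(** * Sums over splittings of a word *)
Section Signed.
Variable V : zmodType.

Definition signed (e : bool) (v : V) : V := if e then - v else v.

Lemma signed_signed e1 e2 v : signed e1 (signed e2 v) = signed (e1 (+) e2) v.
Proof. by case: e1 e2 => [] [] //=; rewrite opprK. Qed.

Lemma signed0 e : signed e 0 = 0.
Proof. by case: e; rewrite //= oppr0. Qed.

Lemma signedD e v w : signed e (v + w) = signed e v + signed e w.
Proof. by case: e; rewrite //= opprD. Qed.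

Lemma signedN e v : signed e (- v) = - signed e v.
Proof. by case: e. Qed.

Lemma signed_sum e (I : Type) (s : seq I) (P : pred I) (f : I -> V) :
  signed e (\sum_(i <- s | P i) f i) = \sum_(i <- s | P i) signed e (f i).
Proof. by case: e; rewrite //= sumrN. Qed.

End Signed.

Lemma raddf_signed (U V : zmodType) (f : {additive U -> V}) e v :
  f (signed e v) = signed e (f v).
Proof. by case: e; rewrite //= raddfN. Qed.

Lemma signedZ (R : pzRingType) (V : lmodType R) e (a : R) (v : V) :
  signed e (a *: v) = a *: signed e v.
Proof. by case: e; rewrite //= scalerN. Qed.

Lemma submodule_signed (R : pzRingType) (V : lmodType R) (W : submodule V) e v :
  W v -> W (signed e v).
Proof.
case: e => //= Wv; rewrite -[- v]add0r.
by apply: submoduleB => //; exact: submodule0.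
Qed.

Lemma linear_signed (R : pzRingType) (U V : lmodType R) (f : U -> V) e x :
  linear f ->
  signed e (f x) = f (signed e x).
Proof. by move=> fl; rewrite -[RHS]/(linear_bundle fl _) raddf_signed. Qed.

Section SplitSum.
Variables (L : Type) (V : zmodType).
Implicit Types (f g : seq L -> seq L -> V) (w : seq L).

(** Writing all index sums as iterated sums over splittings [w = p ++ q] makes
    reindexing a matter of the coassociativity [split_sumA]. Empty pieces are
    allowed; where the theory excludes them, the summand is set to zero. *)
Definition split_sum f w : V :=
  \sum_(0 <= i < (size w).+1) f (take i w) (drop i w).

Lemma split_sum_nil f : split_sum f [::] = f [::] [::].
Proof. by rewrite /split_sum big_nat1. Qed.

Lemma split_sum_cons f x w :
  split_sum f (x :: w) = f [::] (x :: w) + split_sum (fun p => f (x :: p)) w.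
Proof. by rewrite /split_sum big_nat_recl. Qed.

Lemma eq_split_sum f g w :
  (forall p q, p ++ q = w -> f p q = g p q) -> split_sum f w = split_sum g w.
Proof.
by move=> fg; apply: eq_bigr => i _; apply: fg; rewrite cat_take_drop.
Qed.

Lemma split_sumD f g w :
  split_sum (fun p q => f p q + g p q) w = split_sum f w + split_sum g w.
Proof. exact: big_split. Qed.

Lemma split_sumN f w : split_sum (fun p q => - f p q) w = - split_sum f w.
Proof. exact: sumrN. Qed.

Lemma split_sum0 w : split_sum (fun _ _ => 0) w = 0.
Proof. exact: big1. Qed.

Lemma signed_split_sum e f w :
  signed e (split_sum f w) = split_sum (fun p q => signed e (f p q)) w.
Proof. exact: signed_sum. Qed.

Lemma exchange_split_sum (h : seq L -> seq L -> seq L -> seq L -> V) w w' :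
  split_sum (fun p q => split_sum (h p q) w') w =
  split_sum (fun p' q' => split_sum (fun p q => h p q p' q') w) w'.
Proof. exact: exchange_big. Qed.

Lemma split_sum_cat f p x q :
  split_sum f (p ++ x :: q) =
  split_sum (fun a b => f a (b ++ x :: q)) p +
  split_sum (fun a b => f (p ++ x :: a) b) q.
Proof.
elim: p f => [|y p IH] f; first by rewrite split_sum_nil split_sum_cons.
by rewrite !cat_cons !split_sum_cons IH addrA.
Qed.

Lemma split_sumA (h : seq L -> seq L -> seq L -> V) w :
  split_sum (fun p r => split_sum (fun a b => h a b r) p) w =
  split_sum (fun a q => split_sum (fun b r => h a b r) q) w.
Proof.
elim: w h => [|x w IH] h; first by rewrite !split_sum_nil.
rewrite !split_sum_cons split_sum_nil -IH -addrA; congr (_ + _).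
by rewrite -split_sumD; apply: eq_split_sum => p q _; rewrite split_sum_cons.
Qed.

End SplitSum.

Lemma linear_split_sum (R : pzRingType) (X : Type) (U V : lmodType R)
    (f : U -> V) (h : seq X -> seq X -> U) w : linear f ->
  split_sum (fun p q => f (h p q)) w = f (split_sum h w).
Proof. by move=> fl; rewrite -[RHS]/(linear_bundle fl _) raddf_sum. Qed.

(** * Sums over signed rotations of a word *)
Section CyclicSum.
Variables (L : Type) (par : L -> bool) (V : zmodType).
Implicit Types (f g : seq L -> V) (w z : seq L).

Definition word_parity w : bool := foldr (fun x => addb (par x)) false w.

Lemma word_parity_cat p q :
  word_parity (p ++ q) = word_parity p (+) word_parity q.
Proof. by elim: p => //= x p ->; rewrite addbA. Qed.

(** The Koszul sign of exchanging [p] and [q]. *)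
Definition rotation_sign p q : bool := word_parity p && word_parity q.

(** Acting on functions rather than on words keeps track of the sign. Since
    the total sign of a full turn is trivial ([iter_rotate_fun_size]), this
    generates an action of a cyclic group on functions on words of a given
    length, and [cyclic_sum] is its norm. *)
Definition rotate_fun f z : V :=
  signed (rotation_sign (take 1 z) (drop 1 z)) (f (rot 1 z)).

(** The Koszul signs of successive one-letter rotations multiply to the Koszul
    sign of the composite rotation. *)
Lemma iter_rotate_fun k f z : (k <= size z)%N ->
  iter k rotate_fun f z =
  signed (rotation_sign (take k z) (drop k z)) (f (rot k z)).
Proof.
elim: k z => [|k IH] z; first by rewrite take0 /rotation_sign rot0.
case: z => [//|x v]; rewrite ltnS => kv; rewrite iterS {1}/rotate_fun.
have -> : rot 1 (x :: v) = rcons v x by rewrite rot1_cons.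
rewrite IH; last by rewrite size_rcons ltnW.
rewrite signed_signed /= take0 drop0.
have kv' : take k (rcons v x) = take k v by rewrite -cats1 takel_cat.
have kv'' : drop k (rcons v x) = drop k v ++ [:: x].
  by rewrite -cats1 drop_cat; case: ltngtP kv => // ->; rewrite subnn drop_size.
rewrite /rot kv' kv'' /= -catA; congr signed.
rewrite /rotation_sign word_parity_cat /= addbF -{1}[v](cat_take_drop k).
rewrite word_parity_cat.
by case: (par x); case: (word_parity (take _ _)); case: (word_parity _).
Qed.

Lemma iter_rotate_fun_size f w : iter (size w) rotate_fun f w = f w.
Proof.
by rewrite iter_rotate_fun // take_size drop_size rot_size /rotation_sign andbF.
Qed.

Definition cyclic_sum f w : V :=
  \sum_(0 <= k < size w) iter k rotate_fun f w.

Lemma eq_cyclic_sum f g w :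
  (forall k, f (rot k w) = g (rot k w)) -> cyclic_sum f w = cyclic_sum g w.
Proof.
move=> fg; rewrite /cyclic_sum big_nat [RHS]big_nat; apply: eq_bigr => k.
by move=> /andP[_ /ltnW kw]; rewrite !iter_rotate_fun // fg.
Qed.

Lemma cyclic_sum_rotate_fun f w : cyclic_sum (rotate_fun f) w = cyclic_sum f w.
Proof.
rewrite /cyclic_sum; under eq_bigr do rewrite -iterSr.
case: w => [|x v]; first by rewrite !big_nil.
rewrite /= big_nat_recr //= [RHS]big_nat_recl //= addrC; congr (_ + _).
exact: (iter_rotate_fun_size f (x :: v)).
Qed.

Lemma cyclic_sum_iter_rotate_fun k f w :
  cyclic_sum (iter k rotate_fun f) w = cyclic_sum f w.
Proof. by elim: k => //= k IH; rewrite cyclic_sum_rotate_fun. Qed.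

Lemma rotate_fun_cyclic_sum f w : rotate_fun (cyclic_sum f) w = cyclic_sum f w.
Proof.
rewrite -[RHS]cyclic_sum_rotate_fun /rotate_fun /cyclic_sum signed_sum size_rot.
by apply: eq_bigr => k _; rewrite -iterSr.
Qed.

Lemma cyclic_sum_cat f p q :
  cyclic_sum f (p ++ q) = signed (rotation_sign p q) (cyclic_sum f (q ++ p)).
Proof.
have it k w : iter k rotate_fun (cyclic_sum f) w = cyclic_sum f w.
  elim: k w => //= k IH w; rewrite {1}/rotate_fun IH.
  exact: rotate_fun_cyclic_sum.
rewrite -(it (size p)) iter_rotate_fun ?size_cat ?leq_addr //.
by rewrite take_size_cat // drop_size_cat // rot_size_cat.
Qed.

(** The rotations of [x :: v] are indexed by the splittings of [v], which
    gives the position of [x]. *)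
Lemma cyclic_sum_cons f x v :
  cyclic_sum f (x :: v) =
  split_sum (fun v1 v2 =>
    signed (rotation_sign (x :: v1) v2) (f (v2 ++ x :: v1))) v.
Proof.
rewrite -cyclic_sum_rotate_fun /cyclic_sum /split_sum /= big_nat [RHS]big_nat.
apply: eq_bigr => k /andP[_ kv].
by rewrite -iterSr iter_rotate_fun.
Qed.

Lemma cyclic_sum_sum (I : Type) (s : seq I) (f : I -> seq L -> V) w :
  cyclic_sum (fun z => \sum_(i <- s) f i z) w =
  \sum_(i <- s) cyclic_sum (f i) w.
Proof.
rewrite /cyclic_sum exchange_big /= big_nat [RHS]big_nat; apply: eq_bigr => k.
move=> /andP[_ /ltnW kw]; rewrite iter_rotate_fun // signed_sum.
by apply: eq_bigr => i _; rewrite iter_rotate_fun.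
Qed.

Lemma cyclic_sumD f g w :
  cyclic_sum (fun z => f z + g z) w = cyclic_sum f w + cyclic_sum g w.
Proof.
rewrite /cyclic_sum -big_split /= big_nat [RHS]big_nat; apply: eq_bigr => k.
by move=> /andP[_ /ltnW kw]; rewrite !iter_rotate_fun // signedD.
Qed.

Lemma cyclic_sumN f w : cyclic_sum (fun z => - f z) w = - cyclic_sum f w.
Proof.
rewrite /cyclic_sum -sumrN /= big_nat [RHS]big_nat; apply: eq_bigr => k.
by move=> /andP[_ /ltnW kw]; rewrite !iter_rotate_fun // signedN.
Qed.

Lemma cyclic_sum0 f w : (forall k, f (rot k w) = 0) -> cyclic_sum f w = 0.
Proof.
move=> f0; rewrite /cyclic_sum big_nat big1 // => k /andP[_ /ltnW kw].
by rewrite iter_rotate_fun // f0 signed0.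
Qed.

(** Exchanging the two pieces of a splitting is a rotation, under which the
    cyclic sum is invariant. *)
Lemma cyclic_split_sum_swap (f : seq L -> seq L -> V) w :
  cyclic_sum (split_sum f) w =
  cyclic_sum (split_sum (fun p q => signed (rotation_sign p q) (f q p))) w.
Proof.
pose N := size w.
have fix_size (g : seq L -> seq L -> V) : cyclic_sum (split_sum g) w =
    \sum_(0 <= i < N.+1) cyclic_sum (fun z => g (take i z) (drop i z)) w.
  rewrite -cyclic_sum_sum; apply: eq_cyclic_sum => k.
  by rewrite /split_sum size_rot.
rewrite !fix_size big_nat_rev /= add0n big_nat [RHS]big_nat.
apply: eq_bigr => i /andP[_]; rewrite ltnS subSS => iN.
rewrite -(cyclic_sum_iter_rotate_fun i); apply: eq_cyclic_sum => k.
have iz : (i <= size (rot k w))%N by rewrite size_rot.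
rewrite iter_rotate_fun //; congr signed.
have Ni : (N - i)%N = size (drop i (rot k w)) by rewrite size_drop size_rot.
by rewrite Ni [rot i _]/rot take_size_cat // drop_size_cat.
Qed.

End CyclicSum.

(** * Cancellation in the square of a cyclic differential *)
Section SquareZero.
Variables (L : Type) (par isM : L -> bool) (V : zmodType).
Variables (T : seq L -> V) (op : seq L -> L) (b : {additive V -> V}).

Local Notation wpar := (word_parity par).
Local Notation rsign := (rotation_sign par).
Local Notation csum := (cyclic_sum par).

(** The test on [u] is the convention that an empty subword is never
    contracted. *)
Definition insert_op u v : V := if nilp u then 0 else T (op u :: v).

Hypothesis op_par : forall u, (count isM u <= 1)%N -> ~~ nilp u ->
  par (op u) = ~~ wpar u.
Hypothesis op_isM : forall u, (count isM u <= 1)%N -> isM (op u) = has isM u.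
Hypothesis T_cat : forall p q, count isM (p ++ q) = 1%N ->
  T (p ++ q) = signed (rsign p q) (T (q ++ p)).
Hypothesis op_relation : forall c s, count isM (c ++ s) = 1%N ->
  split_sum (fun v => split_sum (fun u t =>
    if nilp u then 0 else signed (wpar v) (T (op (v ++ op u :: t) :: s)))) c
  = 0.
Hypothesis bT : forall w, count isM w = 1%N ->
  b (T w) = csum (split_sum insert_op) w.

Lemma count_rot k w : count isM (rot k w) = count isM w.
Proof. by rewrite count_cat addnC -count_cat cat_take_drop. Qed.

Lemma count_op u v : (count isM (u ++ v) <= 1)%N ->
  count isM (op u :: v) = count isM (u ++ v).
Proof.
rewrite count_cat /= => uv1.
have u1 : (count isM u <= 1)%N by apply: leq_trans uv1; rewrite leq_addr.
rewrite op_isM // has_count; congr (_ + _)%N.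
by case: (count isM u) u1 => [|[|]].
Qed.

(** The term of [b (b (T (u ++ v ++ y ++ t)))] in which first [u] and then [y]
    is contracted, the second contraction being preceded by the rotation that
    brings [y] to the front. *)
Definition disjoint_pair u v y t : V :=
  if nilp u || nilp y then 0
  else signed (rsign (op u :: v) (y ++ t)) (T (op y :: t ++ op u :: v)).

(** Moving one odd operation past the other is what produces the sign. *)
Lemma disjoint_pair_swap u v y t : count isM (u ++ v ++ y ++ t) = 1%N ->
  signed (rsign (u ++ v) (y ++ t)) (disjoint_pair y t u v) =
  - disjoint_pair u v y t.
Proof.
move=> M1; rewrite /disjoint_pair orbC.
case: ifP => [|/norP[u0 y0]]; first by rewrite signed0 oppr0.
rewrite catA in M1.
have uv1 : (count isM (u ++ v) <= 1)%N.
  by rewrite -M1 [leqRHS]count_cat leq_addr.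
have yt1 : (count isM (y ++ t) <= 1)%N.
  by rewrite -M1 [leqRHS]count_cat leq_addl.
have M1' : count isM ((op u :: v) ++ (op y :: t)) = 1%N.
  by rewrite count_cat !count_op // -count_cat.
have u1 : (count isM u <= 1)%N.
  by apply: leq_trans uv1; rewrite count_cat leq_addr.
have y1 : (count isM y <= 1)%N.
  by apply: leq_trans yt1; rewrite count_cat leq_addr.
rewrite -cat_cons T_cat // !signed_signed -signedN -[- T _]/(signed true _).
rewrite signed_signed; congr signed.
rewrite /rotation_sign /= !word_parity_cat !op_par //.
by do 4!case: (wpar _).
Qed.

(** The terms whose module letter lies in the first half [p] are rotated onto
    those whose module letter lies in the second half [q]; by
    [disjoint_pair_swap] the two partial sums are opposite. *)
Lemma cyclic_disjoint_pairs w : count isM w = 1%N ->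
  csum (split_sum (fun p q =>
    split_sum (fun u v => split_sum (disjoint_pair u v) q) p)) w = 0.
Proof.
move=> M1.
pose f p q := split_sum (fun u v => split_sum (disjoint_pair u v) q) p.
pose f1 p q := if has isM p then f p q else 0.
pose f2 p q := if has isM p then 0 else f p q.
have fE : csum (split_sum f) w = csum (split_sum f1) w + csum (split_sum f2) w.
  rewrite -cyclic_sumD; apply: eq_cyclic_sum => k; rewrite -split_sumD.
  apply: eq_split_sum => p q _; rewrite /f1 /f2.
  by case: has; rewrite ?addr0 ?add0r.
rewrite -/f fE (cyclic_split_sum_swap _ f2) addrC -[X in _ + X]opprK.
apply/eqP; rewrite subr_eq0; apply/eqP; rewrite -cyclic_sumN.
apply: eq_cyclic_sum => k; rewrite -split_sumN; apply: eq_split_sum => p q pqE.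
have pq1 : count isM (p ++ q) = 1%N.
  by rewrite pqE count_rot.
rewrite /f1 /f2; have -> : has isM q = ~~ has isM p.
  by rewrite !has_count; move: pq1; rewrite count_cat; lia.
case: has => /=; rewrite ?signed0 ?oppr0 //.
rewrite /f [in LHS]exchange_split_sum signed_split_sum -split_sumN.
apply: eq_split_sum => u v uvE; rewrite signed_split_sum -split_sumN.
apply: eq_split_sum => y t ytE; rewrite -uvE -ytE.
by rewrite disjoint_pair_swap // catA uvE ytE.
Qed.

(** The term of [b (b (T (u ++ t ++ s ++ v)))] in which first [u] is contracted
    and then the cyclic subword made of [v], the new letter and [t]. *)
Definition nested_pair u t s v : V :=
  if nilp u then 0
  else signed (rsign (op u :: t ++ s) v) (T (op (v ++ op u :: t) :: s)).

(** Rotating [v] to the front turns the outer subword into a prefix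
    [v ++ u ++ t]; the Koszul signs reduce to that of moving the inner
    operation past [v], which is the sign of the structure relation. *)
Lemma cyclic_nested_pairs w : count isM w = 1%N ->
  csum (split_sum (fun p v =>
    split_sum (fun u r => split_sum (fun t s => nested_pair u t s v) r) p)) w
  = 0.
Proof.
move=> M1; rewrite cyclic_split_sum_swap; apply: cyclic_sum0 => k.
rewrite -[RHS](split_sum0 _ (rot k w)).
transitivity (split_sum (fun v p => split_sum (fun c s => split_sum (fun u t =>
   if nilp u then 0 else signed (wpar v) (T (op (v ++ op u :: t) :: s))) c) p)
   (rot k w)).
  apply: eq_split_sum => v p vpE; rewrite signed_split_sum [RHS]split_sumA.
  apply: eq_split_sum => u r urE; rewrite signed_split_sum.
  apply: eq_split_sum => t s tsE; rewrite /nested_pair.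
  case: ifP => [_|/negbT u0]; first by rewrite signed0.
  have u1 : (count isM u <= 1)%N.
    have <- : count isM (rot k w) = 1%N.
      by rewrite count_rot.
    by rewrite -vpE -urE !count_cat addnCA leq_addr.
  rewrite signed_signed -urE -tsE /rotation_sign /= !word_parity_cat op_par //.
  by congr signed; do 4!case: (wpar _).
rewrite -split_sumA; apply: eq_split_sum => c s csE.
by apply: op_relation; rewrite csE count_rot.
Qed.

Lemma cyclic_differential_square w : count isM w = 1%N -> b (b (T w)) = 0.
Proof.
move=> M1.
have bsum (f : seq L -> seq L -> V) z :
    b (split_sum f z) = split_sum (fun p q => b (f p q)) z by exact: raddf_sum.
have bcsum (f : seq L -> V) z : b (csum f z) = csum (b \o f) z.
  rewrite /cyclic_sum raddf_sum big_nat [RHS]big_nat; apply: eq_bigr => k.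
  by move=> /andP[_ /ltnW kz]; rewrite !iter_rotate_fun //= raddf_signed.
rewrite bT // bcsum.
transitivity (csum (fun z => split_sum (fun p q =>
    split_sum (fun u v => split_sum (disjoint_pair u v) q) p) z +
  split_sum (fun p v =>
    split_sum (fun u r => split_sum (fun t s => nested_pair u t s v) r)
      p) z) w).
  apply: eq_cyclic_sum => k /=; rewrite bsum !split_sumA -split_sumD.
  apply: eq_split_sum => u v uvE; rewrite /insert_op.
  case: ifP => [u0|u0].
    rewrite raddf0 -split_sumD -[LHS](split_sum0 _ v).
    apply: eq_split_sum => p q _; rewrite /disjoint_pair /nested_pair u0 /=.
    by rewrite !split_sum0 addr0.
  have uv1 : count isM (u ++ v) = 1%N.
    by rewrite uvE count_rot.
  rewrite bT ?count_op ?uv1 // cyclic_sum_cons -split_sumD.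
  apply: eq_split_sum => v1 v2 v12E; rewrite split_sum_cat signedD.
  rewrite !signed_split_sum; congr (_ + _).
    apply: eq_split_sum => y t ytE; rewrite /insert_op /disjoint_pair u0 /=.
    by case: ifP => _; rewrite ?signed0 // ytE.
  apply: eq_split_sum => t s tsE; rewrite /insert_op /nested_pair u0 tsE.
  by case: v2 {v12E}.
by rewrite cyclic_sumD cyclic_disjoint_pairs // cyclic_nested_pairs // addr0.
Qed.

End SquareZero.

(** * Signs and slices *)
Section Parity.
Definition parity (k : int) : bool := odd `|k|%N.

Lemma parityD a b : parity (a + b) = parity a (+) parity b.
Proof. rewrite /parity; lia. Qed.

Lemma parityM a b : parity (a * b) = parity a && parity b.
Proof. by rewrite /parity abszM oddM. Qed.

Lemma sign_signed (R : pzRingType) (V : lmodType R) k (v : V) :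
  sign R k *: v = signed (parity k) v.
Proof. by rewrite /sign -signr_odd scaler_sign. Qed.
End Parity.

Section Slices.
Variable X : Type.
Implicit Types p s : seq X.

Lemma slice1 p j : slice p 1 j = take j p.
Proof. by rewrite /slice drop0. Qed.

Lemma slice_size p i : slice p i (size p) = drop i.-1 p.
Proof. by rewrite /slice take_size. Qed.

Lemma slice_width p i n : (0 < i)%N ->
  slice p i (i + n).-1 = take n (drop i.-1 p).
Proof. by case: i => //= i _; rewrite /slice take_drop addnC. Qed.

Lemma slice_catl p s i j : (j <= size p)%N -> slice (p ++ s) i j = slice p i j.
Proof. by move=> jp; rewrite /slice takel_cat. Qed.

Lemma slice_catr p s i j : (0 < i)%N ->
  slice (p ++ s) (size p + i) (size p + j) = slice s i j.
Proof.
case: i => // i _; rewrite /slice addnS /= take_cat ltnNge leq_addr /= addKn.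
by rewrite drop_cat ltnNge leq_addr /= addKn.
Qed.

End Slices.

Section SplitSumIndices.
Variables (X : Type) (V : zmodType).

Lemma split_sum_map (Y : Type) (g : X -> Y) (f : seq Y -> seq Y -> V) w :
  split_sum f (map g w) = split_sum (fun p q => f (map g p) (map g q)) w.
Proof.
rewrite /split_sum size_map; apply: eq_bigr => i _.
by rewrite map_take map_drop.
Qed.

Lemma exchange_triangle (r : nat) (f : nat -> nat -> V) :
  \sum_(0 <= j < r.+1) \sum_(1 <= e < (r - j).+1) f e j =
  \sum_(1 <= e < r.+1) \sum_(0 <= j < r.+1 - e) f e j.
Proof.
transitivity (\sum_(0 <= j < r.+1) \sum_(1 <= e < r.+1)
    if (j + e <= r)%N then f e j else 0).
  rewrite big_nat [RHS]big_nat; apply: eq_bigr => j /andP[_ jr].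
  rewrite (@big_nat_widen _ _ _ _ _ r.+1) ?ltnS ?leq_subr // big_mkcond /=.
  apply: eq_bigr => e _; congr (if _ then _ else _); lia.
rewrite exchange_big /= big_nat [RHS]big_nat; apply: eq_bigr => e /andP[e0 er].
rewrite [RHS](@big_nat_widen _ _ _ _ _ r.+1) ?leq_subr // [RHS]big_mkcond /=.
apply: eq_bigr => j _; congr (if _ then _ else _); lia.
Qed.

(** The right-hand side is the shape of the defining relations: [n] is the
    length of the inner argument list and [i] its starting position. *)
Lemma triple_split_sum_indices (g : seq X -> seq X -> seq X -> V) p
    (r := size p) :
  split_sum (fun v => split_sum (fun u t =>
    if nilp u then 0 else g v u t)) p =
  \sum_(1 <= n < r.+1) \sum_(1 <= i < (r.+1 - n).+1)
    g (slice p 1 i.-1) (slice p i (i + n).-1) (slice p (i + n) r).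
Proof.
pose f e j := g (take j p) (take e (drop j p)) (drop (j + e) p).
transitivity (\sum_(0 <= j < r.+1) \sum_(1 <= e < (r - j).+1) f e j).
  rewrite /split_sum big_nat [RHS]big_nat; apply: eq_bigr => j /andP[_ jr].
  rewrite big_ltn // take0 add0r size_drop big_nat [RHS]big_nat.
  apply: eq_bigr => e /andP[e0 er]; rewrite /f drop_drop addnC.
  have -> // : nilp (take e (drop j p)) = false.
  by rewrite /nilp size_take size_drop -/r; case: ifP; lia.
rewrite exchange_triangle; apply: eq_bigr => e _; rewrite [RHS]big_add1.
by apply: eq_bigr => j _; rewrite slice1 slice_width // /r slice_size addSn.
Qed.

End SplitSumIndices.

(** * Hochschild chains as cyclic words *)
Section Chains.
Variables (R : comPzRingType) (A : ainf_algebra R) (M : ainf_bimodule A).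

Local Notation mu := (mu_homog (@ainf_mu R A)).
Local Notation muM := (muM_homog (@bimod_mu R A M)).

Definition letter : Type := (homogeneous M + homogeneous A)%type.

Definition is_module_letter (x : letter) : bool :=
  if x is inl _ then true else false.

(** Elements of [A] are shifted and elements of [M] are not, so that both
    structure maps have degree one ([letter_degree_op]). *)
Definition letter_degree (x : letter) : int :=
  match x with inl m => mdeg m | inr a => mdeg a - 1 end.

Definition word_degree (w : seq letter) : int := \sum_(x <- w) letter_degree x.

Definition letter_parity (x : letter) : bool := parity (letter_degree x).

Definition algebra_word (s : seq (homogeneous A)) : seq letter :=
  [seq inr a | a <- s].

Definition algebra_part (w : seq letter) : seq (homogeneous A) :=
  pmap (fun x : letter => if x is inr a then Some a else None) w.

Local Notation wpar := (word_parity letter_parity).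
Local Notation rsign := (rotation_sign letter_parity).
Local Notation csum := (cyclic_sum letter_parity).
Local Notation aw := algebra_word.
Local Notation countM := (count is_module_letter).

(** The word is rotated until the module letter comes first. The value on
    words without module letter is arbitrary. *)
Definition word_tensor (w : seq letter) : chains M :=
  let i := find is_module_letter w in
  if drop i w is inl m :: q then
    signed (rsign (take i w) (drop i w))
      (tensor m (algebra_part q ++ algebra_part (take i w)))
  else 0.

Definition word_op (u : seq letter) : letter :=
  let i := find is_module_letter u in
  if drop i u is inl m :: q then
    inl (muM (algebra_part (take i u)) m (algebra_part q))
  else inr (mu (algebra_part u)).

Lemma algebra_wordK : cancel algebra_word algebra_part.
Proof. by elim=> //= a s ->. Qed.

Lemma algebra_word_cat p q : aw (p ++ q) = aw p ++ aw q.
Proof. exact: map_cat. Qed.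

Lemma algebra_word_take k s : aw (take k s) = take k (aw s).
Proof. exact: map_take. Qed.

Lemma algebra_word_drop k s : aw (drop k s) = drop k (aw s).
Proof. exact: map_drop. Qed.

Lemma count_algebra_word s : countM (aw s) = 0%N.
Proof. by elim: s. Qed.

Lemma find_algebra_word p m q :
  find is_module_letter (aw p ++ inl m :: q) = size (aw p).
Proof. by rewrite find_cat has_count count_algebra_word /= addn0. Qed.

Lemma word_tensorE p m q : word_tensor (aw p ++ inl m :: aw q) =
  signed (rsign (aw p) (inl m :: aw q)) (tensor m (q ++ p)).
Proof.
rewrite /word_tensor find_algebra_word drop_size_cat // take_size_cat //.
by rewrite !algebra_wordK.
Qed.

Lemma word_tensor0 m q : word_tensor (inl m :: aw q) = tensor m q.
Proof. by rewrite (word_tensorE [::]) cats0. Qed.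

Lemma word_op_module p m q :
  word_op (aw p ++ inl m :: aw q) = inl (muM p m q).
Proof.
rewrite /word_op find_algebra_word drop_size_cat // take_size_cat //.
by rewrite !algebra_wordK.
Qed.

Lemma word_op_algebra p : word_op (aw p) = inr (mu p).
Proof.
rewrite /word_op drop_oversize ?algebra_wordK //.
by rewrite leqNgt -has_find has_count count_algebra_word.
Qed.

Lemma word_without_module w : countM w = 0%N -> exists p, w = aw p.
Proof.
elim: w => [|[m|a] w IH] //=; first by exists [::].
by rewrite add0n => /IH [p ->]; exists (a :: p).
Qed.

Lemma word_one_module w : countM w = 1%N ->
  exists p m q, w = aw p ++ inl m :: aw q.
Proof.
elim: w => [|[m|a] w IH] //=.
  by rewrite add1n => -[] /word_without_module [q ->]; exists [::], m, q.
by rewrite add0n => /IH [p [m [q ->]]]; exists (a :: p), m, q.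
Qed.

Lemma word_degree_cat u v :
  word_degree (u ++ v) = word_degree u + word_degree v.
Proof. exact: big_cat. Qed.

Lemma word_degree_cons x v :
  word_degree (x :: v) = letter_degree x + word_degree v.
Proof. exact: big_cons. Qed.

Lemma word_parityE w : wpar w = parity (word_degree w).
Proof.
elim: w => [|x w IH]; first by rewrite /word_degree big_nil.
by rewrite word_degree_cons parityD -IH.
Qed.

Lemma word_degree_algebra s :
  word_degree (aw s) = total_degree s - (size s)%:Z.
Proof.
rewrite /total_degree; elim: s => [|a s IH].
  by rewrite /word_degree !big_nil.
by rewrite word_degree_cons IH !big_cons /= /letter_degree; lia.
Qed.

Lemma word_degree_maltese s : word_degree (aw s) = \sum_(a <- s) (mdeg a - 1).
Proof. exact: big_map. Qed.

Lemma letter_degree_op u : (countM u <= 1)%N ->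
  letter_degree (word_op u) = word_degree u + 1.
Proof.
case E: (countM u) => [|[|//]] _.
  have [p ->] := word_without_module E.
  by rewrite word_op_algebra word_degree_algebra /= /mdeg /=; lia.
have [p [m [q ->]]] := word_one_module E.
rewrite word_op_module word_degree_cat word_degree_cons !word_degree_algebra.
by rewrite /= /mdeg /=; lia.
Qed.

Lemma word_op_parity u : (countM u <= 1)%N -> ~~ nilp u ->
  letter_parity (word_op u) = ~~ wpar u.
Proof.
move=> u1 _; rewrite /letter_parity letter_degree_op // word_parityE parityD.
by rewrite addbT.
Qed.

Lemma word_op_is_module u : (countM u <= 1)%N ->
  is_module_letter (word_op u) = has is_module_letter u.
Proof.
case E: (countM u) => [|[|//]] _.
  have [p ->] := word_without_module E.
  by rewrite word_op_algebra has_count count_algebra_word.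
have [p [m [q ->]]] := word_one_module E.
by rewrite word_op_module has_cat /= orbT.
Qed.

Lemma word_tensor_cat p q : countM (p ++ q) = 1%N ->
  word_tensor (p ++ q) = signed (rsign p q) (word_tensor (q ++ p)).
Proof.
have main u v m d : word_tensor ((aw u ++ inl m :: aw v) ++ aw d) =
    signed (rsign (aw u ++ inl m :: aw v) (aw d))
      (word_tensor (aw d ++ (aw u ++ inl m :: aw v))).
  rewrite -catA cat_cons catA -!algebra_word_cat !word_tensorE signed_signed.
  rewrite -catA; congr signed.
  rewrite /rotation_sign !algebra_word_cat !word_parity_cat /= !word_parity_cat.
  by case: (letter_parity _); do 3!case: (wpar _).
rewrite count_cat; case Ep: (countM p) => [|[|//]] Eq.
  have [u ->] := word_without_module Ep.
  have [v [m [d ->]]] := word_one_module Eq.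
  by rewrite main signed_signed {2}/rotation_sign andbC addbb.
case: Eq => Eq; have [d ->] := word_without_module Eq.
by have [u [m [v ->]]] := word_one_module Ep; exact: main.
Qed.

(** The structure relations hold in a fixed degree [j]; this is what carries
    them to chains. *)
Lemma word_tensor_linear_algebra s j : countM s = 1%N ->
  linear (fun x : A j => word_tensor (inr (homog x) :: s)).
Proof.
move=> /word_one_module [p [m [q ->]]] a x y.
have E (z : A j) : word_tensor (inr (homog z) :: aw p ++ inl m :: aw q) =
    signed (rsign (inr (homog (0 : A j)) :: aw p) (inl m :: aw q))
      (tensor m (q ++ homog z :: p)).
  exact: (word_tensorE (homog z :: p)).
rewrite !E ((tensor_multilinear M).2 m q p j a x y).
by rewrite signedD signedZ.
Qed.

Lemma word_tensor_linear_module s j : countM s = 0%N ->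
  linear (fun x : M j => word_tensor (inl (homog x) :: s)).
Proof.
move=> /word_without_module [q ->] a x y.
by rewrite !word_tensor0 ((tensor_multilinear M).1 q j a x y).
Qed.

(** * The structure relations for words *)
Lemma total_degree_cat (W : graded_module R) (u v : seq (homogeneous W)) :
  total_degree (u ++ v) = total_degree u + total_degree v.
Proof. exact: big_cat. Qed.

Lemma total_degree_cons (W : graded_module R) x (v : seq (homogeneous W)) :
  total_degree (x :: v) = mdeg x + total_degree v.
Proof. exact: big_cons. Qed.

Lemma sign_maltese (a : seq (homogeneous A)) i j (V : lmodType R) (v : V) :
  sign R (maltese a i j) *: v = signed (wpar (aw (slice a i j))) v.
Proof. by rewrite sign_signed word_parityE word_degree_maltese. Qed.

Lemma ainf_split_relation p d :
  split_sum (fun v => split_sum (fun u t =>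
    if nilp u then 0
    else signed (wpar (aw v)) (ainf_mu (v ++ mu u :: t) d))) p = 0.
Proof.
case: (posnP (size p)) => [/size0nil->|p0]; first by rewrite !split_sum_nil.
rewrite (triple_split_sum_indices (fun v u t =>
  signed (wpar (aw v)) (ainf_mu (v ++ mu u :: t) d))).
rewrite -[RHS](ainf_mu_relation d p0); apply: eq_bigr => n _.
by apply: eq_bigr => i _; rewrite sign_maltese.
Qed.

(** The three sums are those of the bimodule relation: the inner operation is
    applied on the left of [m], around [m], and on the right of [m]. *)
Lemma bimod_split_relation p m q d :
  split_sum (fun v => split_sum (fun u t =>
    if nilp u then 0
    else signed (wpar (aw v)) (bimod_mu (v ++ mu u :: t) m q d))) p +
  split_sum (fun v u => split_sum (fun u' t =>
    signed (wpar (aw v)) (bimod_mu v (muM u m u') t d)) q) p +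
  split_sum (fun v => split_sum (fun u t =>
    if nilp u then 0
    else signed (wpar (aw p ++ inl m :: aw v))
           (bimod_mu p m (v ++ mu u :: t) d))) q = 0.
Proof.
rewrite (triple_split_sum_indices (fun v u t =>
  signed (wpar (aw v)) (bimod_mu (v ++ mu u :: t) m q d))).
rewrite (triple_split_sum_indices (fun v u t =>
  signed (wpar (aw p ++ inl m :: aw v)) (bimod_mu p m (v ++ mu u :: t) d))).
(* The bimodule relation also runs over inner operations that are longer than
   the list by one; they have no starting position. *)
have trim k (f : nat -> nat -> M d) :
    \sum_(1 <= n < k.+2) \sum_(1 <= i < (k.+1 - n).+1) f n i =
    \sum_(1 <= n < k.+1) \sum_(1 <= i < (k.+1 - n).+1) f n i.
  by rewrite big_nat_recr //= subnn [X in _ + X]big_geq // addr0.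
rewrite -[RHS](bimod_mu_relation m d (size_cat p q)) !trim.
have sliceq : slice (p ++ q) (size p).+1 (size p + size q) = q.
  by rewrite -addn1 slice_catr // slice1 take_size.
have slicep : slice (p ++ q) 1 (size p) = p.
  by rewrite slice_catl // slice1 take_size.
congr (_ + _ + _).
- rewrite big_nat [RHS]big_nat; apply: eq_bigr => n /andP[n0 np].
  rewrite big_nat [RHS]big_nat; apply: eq_bigr => i /andP[i0 inp].
  rewrite sign_maltese sliceq !slice_catl //; lia.
- rewrite /split_sum big_nat [RHS]big_nat; apply: eq_bigr => i /andP[_ ip].
  apply: eq_bigr => j _; rewrite sign_maltese.
  rewrite -[(size p).+1]addn1 -addnS !slice_catr // !slice_catl //.
  by rewrite !slice1 !slice_size.
- rewrite big_nat [RHS]big_nat; apply: eq_bigr => n /andP[n0 nq].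
  rewrite big_nat [RHS]big_nat; apply: eq_bigr => i /andP[i0 inq].
  have -> : ((size p + i).-1 = size p + i.-1)%N by lia.
  have -> : ((size p + i + n).-1 = size p + (i + n).-1)%N by lia.
  rewrite -addnA -[(size p).+1]addn1 !slice_catr //; last first.
    by rewrite addn_gt0 i0.
  rewrite slicep sign_signed parityD.
  rewrite word_parity_cat /= addbCA addbC.
  congr signed; congr (_ (+) _).
  rewrite -word_parity_cat -algebra_word_cat word_parityE word_degree_maltese.
  by rewrite /maltese !slice1 [in RHS]take_cat ltnNge leq_addr /= addKn.
Qed.

Lemma op_relation_algebra p s : countM s = 1%N ->
  split_sum (fun v => split_sum (fun u t =>
    if nilp u then 0
    else signed (wpar v) (word_tensor (word_op (v ++ word_op u :: t) :: s))))
    (aw p) = 0.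
Proof.
move=> s1.
(* [D] is the degree of [p] shifted by that of two operations: the lengths of
   their argument lists add up to [size p + 1], which gives [2 + 2 - 1]. *)
pose D := total_degree p + 3 - (size p)%:Z.
have fl := word_tensor_linear_algebra (j := D) s1.
rewrite split_sum_map -[RHS](linear_zero fl) -(ainf_split_relation p D).
rewrite -(linear_split_sum _ _ fl); apply: eq_split_sum => v b vbE.
rewrite split_sum_map -(linear_split_sum _ _ fl).
apply: eq_split_sum => u t utE.
rewrite /nilp size_map -/(nilp u).
case: ifP => _; first by rewrite (linear_zero fl).
rewrite -(linear_signed _ _ fl) word_op_algebra.
rewrite -[inr _ :: map _ _]/(aw (mu u :: t)) -algebra_word_cat word_op_algebra.
congr (signed _ (word_tensor (inr _ :: s))); rewrite /mu_homog.
congr (homog (ainf_mu _ _)); rewrite /D -vbE -utE.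
by rewrite !total_degree_cat total_degree_cons !size_cat /= /mdeg /=; lia.
Qed.

(** A splitting of [p, m, q] into three pieces puts [m] into the last, the
    middle or the first one; these cases are the three sums of
    [bimod_split_relation]. *)
Lemma op_relation_module p m q s : countM s = 0%N ->
  split_sum (fun v => split_sum (fun u t =>
    if nilp u then 0
    else signed (wpar v) (word_tensor (word_op (v ++ word_op u :: t) :: s))))
    (aw p ++ inl m :: aw q) = 0.
Proof.
move=> s0.
(* As for algebra words; the sum is the same whether the inner operation is
   [mu] or [mu^M]. *)
pose D := total_degree p + mdeg m + total_degree q
  + 2 - (size p)%:Z - (size q)%:Z.
have fl := word_tensor_linear_module (j := D) s0.
rewrite -[RHS](linear_zero fl) -(bimod_split_relation p m q D).
rewrite -[RHS]/(linear_bundle fl _) !raddfD /= -!(linear_split_sum _ _ fl).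
rewrite split_sum_cat !split_sum_map -split_sumD; congr (_ + _).
  apply: eq_split_sum => v b vbE.
  rewrite split_sum_cat !split_sum_map -!(linear_split_sum _ _ fl).
  congr (_ + _); apply: eq_split_sum => u t utE.
    rewrite /nilp size_map -/(nilp u).
    case: ifP => _; first by rewrite (linear_zero fl).
    rewrite -(linear_signed _ _ fl) word_op_algebra.
    rewrite -[inr _ :: _ ++ _]/(aw (mu u :: t) ++ _) catA -algebra_word_cat.
    rewrite word_op_module.
    congr (signed _ (word_tensor (inl _ :: s))); rewrite /muM_homog.
    congr (homog (bimod_mu _ _ _ _)); rewrite /D -vbE -utE.
    by rewrite !total_degree_cat total_degree_cons !size_cat /= /mdeg /=; lia.
  rewrite /nilp size_cat addnS /= -(linear_signed _ _ fl) !word_op_module.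
  congr (signed _ (word_tensor (inl _ :: s))); rewrite /muM_homog.
  congr (homog (bimod_mu _ _ _ _)); rewrite /D -vbE -utE.
  by rewrite !total_degree_cat !size_cat /= /mdeg /=; lia.
apply: eq_split_sum => v b vbE.
rewrite split_sum_map -(linear_split_sum _ _ fl).
apply: eq_split_sum => u t utE; rewrite /nilp size_map -/(nilp u).
case: ifP => _; first by rewrite (linear_zero fl).
rewrite -(linear_signed _ _ fl) word_op_algebra.
rewrite -[inr _ :: map _ _]/(aw (mu u :: t)) -catA cat_cons -algebra_word_cat.
rewrite word_op_module.
congr (signed _ (word_tensor (inl _ :: s))); rewrite /muM_homog.
congr (homog (bimod_mu _ _ _ _)); rewrite /D -vbE -utE.
by rewrite !total_degree_cat total_degree_cons !size_cat /= /mdeg /=; lia.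
Qed.

Lemma word_op_relation c s : countM (c ++ s) = 1%N ->
  split_sum (fun v => split_sum (fun u t =>
    if nilp u then 0
    else signed (wpar v) (word_tensor (word_op (v ++ word_op u :: t) :: s)))) c
  = 0.
Proof.
rewrite count_cat; case Ec: (countM c) => [|[|//]] Es.
  by have [p ->] := word_without_module Ec; exact: op_relation_algebra.
by have [p [m [q ->]]] := word_one_module Ec; case: Es => /op_relation_module.
Qed.

(** * The Hochschild differential on words *)
Local Notation word_insert := (insert_op word_tensor word_op).

(** For a fixed length [l] of the contracted subword, its starting position
    [k] accounts for the three kinds of terms of [b]: the subword starts at
    [m] for [k = 0], stays among the [a_i] for [1 <= k <= n + 1 - l], and
    wraps around through [m] for larger [k]. *)
Lemma hochschild_tensor_cyclic (m : homogeneous M) (s : seq (homogeneous A)) :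
  hochschild_tensor m s = csum (split_sum word_insert) (inl m :: aw s).
Proof.
pose n := size s; pose w : seq letter := inl m :: aw s.
have sw : size w = n.+1 by rewrite /= size_map.
transitivity (\sum_(1 <= l < n.+2) \sum_(0 <= k < n.+1)
    signed (rsign (take k w) (drop k w))
      (word_insert (take l (rot k w)) (drop l (rot k w)))); last first.
  rewrite exchange_big /= /cyclic_sum sw big_nat [RHS]big_nat.
  apply: eq_bigr => k /andP[_ kn].
  rewrite iter_rotate_fun ?sw 1?ltnW // -signed_sum /split_sum size_rot sw.
  by rewrite [in RHS]big_ltn // take0 add0r.
rewrite /hochschild_tensor -/n big_nat [RHS]big_nat.
apply: eq_bigr => -[//|l] /andP[_ ln].
rewrite [RHS]big_ltn //.
rewrite [X in _ = _ + X](@big_cat_nat _ _ _ (n.+2 - l.+1)) /=; try lia.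
rewrite addrA; congr (_ + _ + _).
- rewrite cats0 /insert_op /=.
  rewrite -algebra_word_take -algebra_word_drop.
  rewrite (word_op_module [::]) word_tensor0.
  by rewrite slice1 /n slice_size.
- have -> : (n.+1 - l.+1).+1 = (n.+2 - l.+1)%N by lia.
  rewrite big_nat [RHS]big_nat; apply: eq_bigr => -[//|k] /andP[_ kn].
  have rotE : rot k.+1 w = aw (drop k s) ++ inl m :: aw (take k s).
    by rewrite /rot /= algebra_word_take algebra_word_drop.
  have lk : (l.+1 <= size (drop k s))%N by rewrite size_drop -/n; lia.
  rewrite rotE takel_cat ?size_map // drop_cat size_map.
  have -> : (if (l.+1 < size (drop k s))%N
      then drop l.+1 (aw (drop k s)) ++ inl m :: aw (take k s)
      else drop (l.+1 - size (drop k s)) (inl m :: aw (take k s))) =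
      aw (drop l.+1 (drop k s)) ++ inl m :: aw (take k s).
    case: (ltngtP l.+1 (size (drop k s))) lk => // [_|e] _.
      by rewrite !algebra_word_drop.
    by rewrite -e subnn (@drop_oversize _ l.+1) ?e.
  rewrite /insert_op -algebra_word_take /nilp size_map size_take.
  have -> : (if (l.+1 < size (drop k s))%N then l.+1 else size (drop k s)) =
    l.+1 by case: (ltngtP l.+1 (size (drop k s))) lk.
  rewrite word_op_algebra -[inr _ :: _ ++ _]/(aw (_ :: _) ++ inl m :: aw _).
  rewrite word_tensorE signed_signed sign_signed.
  rewrite slice_width // slice1 /n slice_size drop_drop addSn /= addnC.
  have muP : letter_parity (inr (mu (take l.+1 (drop k s)))) =
      ~~ wpar (aw (take l.+1 (drop k s))).
    rewrite -word_op_algebra word_op_parity ?count_algebra_word //.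
    by rewrite /nilp size_map size_take; case: ifP; lia.
  congr signed; rewrite /maltese0 parityD /maltese slice1.
  rewrite -word_degree_maltese -word_parityE /rotation_sign /=.
  rewrite -algebra_word_take -algebra_word_drop muP.
  rewrite -{1}[drop k s](cat_take_drop l.+1) algebra_word_cat word_parity_cat.
  rewrite drop_drop -[parity (mdeg m)]/(letter_parity (inl m)).
  by case: (letter_parity _); do 3!case: (wpar _).
rewrite big_nat [RHS]big_nat.
apply: eq_bigr => -[|k] /andP[nk kn]; first by lia.
have rotE : rot k.+1 w = aw (drop k s) ++ inl m :: aw (take k s).
  by rewrite /rot /= algebra_word_take algebra_word_drop.
(* [e] is the number of leading [a_i] that the subword reaches after [m]. *)
pose e := (k + l - n)%N; have ek : (e <= k)%N by rewrite /e; lia.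
have lE : l.+1 = (size (aw (drop k s)) + e.+1)%N.
  by rewrite size_map size_drop -/n /e; lia.
have -> : (k.+1 + l.+1 - n.+2 = e)%N by rewrite /e; lia.
have -> : (k.+1 + l.+1 - n.+1 = e.+1)%N by rewrite /e; lia.
rewrite rotE lE take_cat drop_cat ltnNge leq_addr /= !addKn /=.
rewrite -!algebra_word_take -!algebra_word_drop.
rewrite /insert_op word_op_module word_tensor0 /nilp size_cat addnS /=.
rewrite !slice1 take_takel // /n slice_size sign_signed /slice /=.
congr signed; rewrite parityM /maltese0 parityD /maltese slice1 slice_size /=.
by rewrite -!word_degree_maltese -!word_parityE.
Qed.

Lemma count_module_word m s : countM (inl m :: aw s) = 1%N.
Proof. by rewrite /= count_algebra_word. Qed.

(** Both sides are multiplied by the same Koszul sign under rotation, so one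
    may assume that the module letter comes first. *)
Lemma hochschild_b_word w : countM w = 1%N ->
  hochschild_b M (word_tensor w) = csum (split_sum word_insert) w.
Proof.
move=> w1; have [p [m [q wE]]] := word_one_module w1.
rewrite {}wE in w1 *; rewrite word_tensor_cat // cyclic_sum_cat raddf_signed.
rewrite cat_cons -algebra_word_cat word_tensor0 -hochschild_tensor_cyclic.
by congr signed; exact: hochschild_bE.
Qed.

Lemma hochschild_b_tensor_square m s :
  hochschild_b M (hochschild_b M (tensor m s)) = 0.
Proof.
rewrite -word_tensor0.
apply: (cyclic_differential_square (isM := is_module_letter)
          (par := letter_parity) (op := word_op)).
- exact: word_op_parity.
- exact: word_op_is_module.
- exact: word_tensor_cat.
- exact: word_op_relation.
- exact: hochschild_b_word.
- exact: count_module_word.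
Qed.

Lemma chains_generated (W : submodule (chains M)) :
  (forall m s, W (tensor m s)) -> forall c, W c.
Proof.
move=> Wt c; rewrite -[c]quotient_reprK; set f := quotient_repr c.
have [X f0] := free_supp f; rewrite (free_module_gen f0) linear_sum.
apply: submodule_sum => -[m s] _; rewrite /= linearZ /= -[_ *: _]addr0.
by apply: submoduleL; [exact: Wt|exact: submodule0].
Qed.

Lemma hochschild_b_square c : hochschild_b M (hochschild_b M c) = 0.
Proof.
pose W := submodule_ker (hochschild_b M \o hochschild_b M : {linear _ -> _}).
rewrite -[_ = 0]/(W c); apply: chains_generated => m s.
exact: hochschild_b_tensor_square.
Qed.

(** * Degree and length *)
Lemma word_tensor_filtration (w : seq letter) p : countM w = 1%N ->
  (size w)%:Z <= p + 1 ->
  length_filtration M p (- word_degree w) (word_tensor w).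
Proof.
move=> /word_one_module [u [m [v ->]]] wp; rewrite word_tensorE.
apply: submodule_signed => W; apply; exists m, (v ++ u); split=> //.
  by move: wp; rewrite !size_cat /= !size_map; lia.
rewrite /tensor_degree total_degree_cat size_cat word_degree_cat.
by rewrite word_degree_cons !word_degree_algebra /=; lia.
Qed.

Lemma word_degree_rot k (w : seq letter) :
  word_degree (rot k w) = word_degree w.
Proof. by rewrite word_degree_cat addrC -word_degree_cat cat_take_drop. Qed.

(** Replacing a nonempty subword by a single letter does not lengthen the
    word, and the operation has degree one. *)
Lemma word_insert_filtration w p : countM w = 1%N ->
  (size w)%:Z <= p + 1 ->
  length_filtration M p (- word_degree w - 1) (split_sum word_insert w).
Proof.
move=> w1 wp; apply: submodule_sum => i _; rewrite /insert_op.
case: ifP => [_|u0]; first exact: submodule0.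
set u := take i w in u0 *; set v := drop i w.
have uvE : u ++ v = w by rewrite cat_take_drop.
have u1 : (countM u <= 1)%N by rewrite -w1 -uvE count_cat leq_addr.
have -> : - word_degree w - 1 = - word_degree (word_op u :: v).
  rewrite word_degree_cons letter_degree_op // -uvE word_degree_cat; lia.
apply: word_tensor_filtration.
  rewrite (count_op word_op_is_module) uvE //; by rewrite w1.
by move: wp u0; rewrite -uvE size_cat /= /nilp; lia.
Qed.

Lemma hochschild_b_filtration p n c :
  length_filtration M p n c -> length_filtration M p (n - 1) (hochschild_b M c).
Proof.
move/(_ (submodule_preim (hochschild_b M) (length_filtration M p (n - 1)))).
apply=> _ [m [s [sp <- ->]]]; rewrite -word_tensor0.
suff: length_filtration M p (tensor_degree m s - 1)
  (hochschild_b M (word_tensor (inl m :: aw s))) by [].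
have w1 := count_module_word m s; rewrite hochschild_b_word //.
have -> : tensor_degree m s = - word_degree (inl m :: aw s).
  by rewrite word_degree_cons word_degree_algebra /tensor_degree /=; lia.
rewrite /cyclic_sum big_nat; apply: submodule_sum => k /andP[_ /ltnW kw].
rewrite iter_rotate_fun //; apply: submodule_signed.
rewrite -(word_degree_rot k); apply: word_insert_filtration.
  by rewrite count_rot.
by rewrite size_rot /= size_map; lia.
Qed.

Lemma length_filtration_le p p' n c : p <= p' ->
  length_filtration M p n c -> length_filtration M p' n c.
Proof.
move=> pp' Fc W WF; apply: Fc => _ [m [s [sp sn ->]]].
by apply: WF; exists m, s; split=> //; exact: le_trans pp'.
Qed.

Fact length_filtration_union_subproof n :
  is_submodule (fun c => exists p, length_filtration M p n c).
Proof.
split; first by exists 0; exact: submodule0.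
move=> a x y [p Fx] [p' Fy]; exists (Num.max p p'); apply: submoduleL.
  by apply: length_filtration_le Fx; rewrite le_max lexx.
by apply: length_filtration_le Fy; rewrite le_max lexx orbT.
Qed.

Lemma length_filtration_exhaustive n c :
  chain_degree M n c <-> exists p, length_filtration M p n c.
Proof.
split=> [|[p Fc] W WC]; last first.
  by apply: Fc => _ [m [s [_ sn ->]]]; apply: WC; exists m, s.
move/(_ (Submodule (length_filtration_union_subproof n))).
apply=> _ [m [s [sn ->]]]; exists (size s)%:Z => W; apply.
by exists m, s.
Qed.

Lemma length_filtration_below p n c :
  p < 0 -> length_filtration M p n c -> c = 0.
Proof.
move=> p0 /(_ (submodule_ker (@idfun (chains M)))); apply.
by move=> y [m [s [sp sn yE]]]; move: (le_lt_trans sp p0).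
Qed.

Lemma hochschild_filtered_complex :
  filtered_complex (chain_degree M) (length_filtration M) (hochschild_b M).
Proof.
split; last exact: length_filtration_exhaustive.
- split; last exact: hochschild_b_square.
  move=> n x /length_filtration_exhaustive [p Fx].
  apply/length_filtration_exhaustive; exists p.
  exact: hochschild_b_filtration.
- exact: hochschild_b_filtration.
- by move=> p n x; apply: length_filtration_le; rewrite gerBl.
Qed.

End Chains.

Theorem theorem5p6 (R : comPzRingType) (A : ainf_algebra R)
    (M : ainf_bimodule A) :
  [/\ filtered_complex (chain_degree M) (length_filtration M) (hochschild_b M),
      exists d : page_differentials (length_filtration M) (hochschild_b M),
        is_spectral_sequence d
    & converges_to_homology (chain_degree M) (length_filtration M)
        (hochschild_b M)].
Proof.
have [[_ bb] bF FS exh] := hochschild_filtered_complex M.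
split; first exact: hochschild_filtered_complex.
  exists (induced_differentials bF bb).
  exact: filtered_complex_spectral_sequence.
exact: (filtered_complex_converges _ FS exh (@length_filtration_below _ _ M)).
Qed.
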